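(* In the setting described in the context (no ramified irregular singular points), fix $\boldsymbol t_0\in T_{\boldsymbol t}$ and $\boldsymbol\theta\in T_{\boldsymbol\theta}$, and let $\omega$ be the $2$-form on $\mathcal M_{\boldsymbol t_0}$ defined in the context by residues. Then $\omega$ coincides with $$\sum_{j=1}^{n-3}d\Big(\frac{p_j}{P(q_j)}\Big)\wedge dq_j .$$
   Context: **Setting (no ramified points).** Let $\nu\ge 2$, $I=\{1,\dots,\nu,\infty\}$, $t_1=0$, $t_2=1$, $t_\infty=\infty\in\mathbb P^1$. Let $n_i\ge1$ ($i\in I$) be integers, $n=\sum_{i\in I}n_i$, and $I=I_{\mathrm{reg}}\sqcup I_{\mathrm{un}}$ with $n_i=1$ for $i\in I_{\mathrm{reg}}$, $n_i>1$ for $i\in I_{\mathrm{un}}$. Let $x$ be the affine coordinate on $U_0=\mathbb P^1\setminus\{\infty\}$, $w=1/x$ the coordinate on $U_\infty=\mathbb P^1\setminus\{0\}$; $x_{t_i}=x-t_i$ for $i\ne\infty$, $x_{t_\infty}=w$. $T_{\boldsymbol t}$ is the set of $(t_3,\dots,t_\nu)\in\mathbb C^{\nu-2}$ with pairwise distinct entries $\notin\{0,1\}$. $T_{\boldsymbol\theta}$ is the set of tuples $\boldsymbol\theta=(\theta^{\pm}_{l,t_i})_{i\in I_{\mathrm{un}},\,0\le l\le n_i-2}$ of complex numbers with $\theta^+_{0,t_i}\ne\theta^-_{0,t_i}$. Fix constants $\boldsymbol\theta_0=(\theta^\pm_{n_i-1,t_i})_{i\in I}$ with $\sum_{i\in I}(\theta^+_{n_i-1,t_i}+\theta^-_{n_i-1,t_i})=-1$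 and $\theta^+_{0,t_i}-\theta^-_{0,t_i}\notin\mathbb Z$ for $i\in I_{\mathrm{reg}}$. For $\boldsymbol t_0=(t_3,\dots,t_\nu)\in T_{\boldsymbol t}$ let $\mathcal M_{\boldsymbol t_0}$ be the set of $\{(q_1,p_1),\dots,(q_{n-3},p_{n-3})\}\in\mathrm{Sym}^{(n-3)}(\mathbb C^2)$ with the $q_j$ pairwise distinct and $q_j\notin\{0,1,t_3,\dots,t_\nu,\infty\}$. Put $P(x)=\prod_{i=1}^\nu(x-t_i)^{n_i}$. **Bundles, local data.** $E_k=\mathcal O_{\mathbb P^1}\oplus\mathcal O_{\mathbb P^1}(k)$ is given by trivializations on $U_0,U_\infty$ with transition matrix $G_k=\mathrm{diag}(1,x^k)$ from $U_\infty$ to $U_0$; a connection $d+\Omega$ on $U_0$ reads $d+G_k^{-1}dG_k+G_k^{-1}\Omega G_k$ on $U_\infty$. A connection matrix $\Omega$ at $t_i$ (the one on $U_\infty$ if $i=\infty$) has local formal data $(\theta^\pm_{l,t_i})_{0\le l\le n_i-1}$ if there is $M\in GL_2(\mathbb C[[x_{t_i}]])$ with $M^{-1}dM+M^{-1}\Omega M=\sum_{l=0}^{n_i-1}\mathrm{diag}(\theta^+_{l,t_i},\theta^-_{l,t_i})\,x_{t_i}^{-n_i+l}dx_{t_i}$. **Normal form (Diarra–Loray).** For each point of $\mathcal M_{\boldsymbol t_0}$ there is a unique connection $d+\Omega^{(n-2)}$ on $E_{n-2}$, with $\Omega^{(n-2)}=\begin{pmatrix}0&1/P(x)\\ c_0(x)&d_0(x)\end{pmatrix}dx$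 on $U_0$, $$c_0=\sum_{i=1}^\nu\frac{C_i(x)}{(x-t_i)^{n_i}}+\sum_{j=1}^{n-3}\frac{p_j}{x-q_j}+\tilde C(x)+x^{n-3}C_\infty(x),\qquad d_0=\sum_{i=1}^\nu\frac{D_i(x)}{(x-t_i)^{n_i}}-\sum_{j=1}^{n-3}\frac1{x-q_j}+D_\infty(x),$$ $C_i,D_i,C_\infty,D_\infty,\tilde C$ polynomials in $x$ with $\deg C_i,\deg D_i\le n_i-1$ ($i\le\nu$), $\deg C_\infty\le n_\infty-1$, $\deg D_\infty\le n_\infty-2$, $\deg\tilde C\le n-4$, such that (a) each $q_j$ is an apparent singularity, i.e. with $\tilde\Phi_{q_j}=\begin{pmatrix}1&0\\ p_j&x-q_j\end{pmatrix}$ the matrix $\tilde\Phi_{q_j}^{-1}d\tilde\Phi_{q_j}+\tilde\Phi_{q_j}^{-1}\Omega^{(n-2)}\tilde\Phi_{q_j}$ has no pole at $q_j$, and (b) its local formal data at every $t_i$, $i\in I$, is given by $(\boldsymbol\theta,\boldsymbol\theta_0)$. Write $\Omega^{(n-2)}_\infty=G_{n-2}^{-1}dG_{n-2}+G_{n-2}^{-1}\Omega^{(n-2)}G_{n-2}$. **Formal solutions.** For $i\in I$ let $\Phi_i\in GL_2(\mathbb C)$ (compatible framing) be such that $\Phi_i^{-1}\Omega^{(n-2)}\Phi_i$ has leading coefficient $\mathrm{diag}(\theta^+_{0,t_i},\theta^-_{0,t_i})$ of $x_{t_i}^{-n_i}dx_{t_i}$ (use $\Omega^{(n-2)}_\infty$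 if $i=\infty$; the leading coefficient does not depend on the $(q_j,p_j)$, and $\Phi_i$ is fixed independently of them). There are unique functions $\theta^\pm_{l,t_i}$ ($l\ge n_i$) on $\mathcal M_{\boldsymbol t_0}$ and a unique formal series $\Xi_i=\mathrm{id}+\sum_{s\ge1}\begin{pmatrix}0&*\\ *&0\end{pmatrix}x_{t_i}^s$ such that $\psi_i=\Phi_i\,\Xi_i(x_{t_i})\exp(-\Lambda_i(x_{t_i}))$, $\Lambda_i=\mathrm{diag}(\hat\lambda_i^+,\hat\lambda_i^-)$, $\hat\lambda_i^\pm=\sum_{l\ge0}\theta^\pm_{l,t_i}\int x_{t_i}^{-n_i+l}dx_{t_i}$, is a formal fundamental solution of $(d+\Omega^{(n-2)})\psi_i=0$ at $t_i$. At $q_j$ let $\psi_{q_j}=\begin{pmatrix}1&0\\ p_j&1\end{pmatrix}\Xi_{q_j}(x)\,\mathrm{diag}(1,x-q_j)$, with $\Xi_{q_j}$ a convergent power series in $x-q_j$, $\Xi_{q_j}(q_j)=\mathrm{id}$, be a fundamental solution of $(d+\Omega^{(n-2)})\psi_{q_j}=0$. **The 2-form $\omega$.** A vector field $\delta$ on $\mathcal M_{\boldsymbol t_0}$ acts on matrices depending on $x$ and on the parameters with $x$ fixed. Put $\delta(A)\wedge\delta(\psi)\psi^{-1}=\delta_1(A)\delta_2(\psi)\psi^{-1}-\delta_1(\psi)\psi^{-1}\delta_2(A)$ and, for vector fields $\delta_1,\delta_2$ on $\mathcal M_{\boldsymbol t_0}$, $$\omega(\delta_1,\delta_2)=\tfrac12\sum_{i\in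 I}\mathrm{res}_{x=t_i}\mathrm{Tr}\big(\delta(\Omega^{(n-2)})\wedge\delta(\psi_i)\psi_i^{-1}\big)+\tfrac12\sum_{j=1}^{n-3}\mathrm{res}_{x=q_j}\mathrm{Tr}\big(\delta(\Omega^{(n-2)})\wedge\delta(\psi_{q_j})\psi_{q_j}^{-1}\big)$$ (with $\Omega^{(n-2)}_\infty$ for $i=\infty$); this is independent of the choices of $\psi_i,\psi_{q_j}$. *)

(* Defs.v *)
From HB Require Import structures.
From mathcomp Require Import all_boot all_order all_algebra.
From mathcomp Require Import zify complex fraction generic_quotient.
From mathcomp Require Import boolp classical_sets fsbigop.
From mathcomp Require Import reals topology normedtype derive.

Set Implicit Arguments.
Unset Strict Implicit.
Unset Printing Implicit Defensive.
Import Order.TTheory GRing.Theory Num.Theory.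
Import numFieldNormedType.Exports.
Local Open Scope ring_scope.

(* Formal Laurent series in one variable u, as a field *)
Section Laurent.
Variable F : fieldType.
Implicit Types (a b : int -> F) (c : F) (N M K L : nat).

Definition lbound a N := forall k : int, k < - N%:Z -> a k = 0.

(* \sum_k lcoef k u^k, with finitely many negative exponents *)
Record laurent := Laurent {
  lcoef :> int -> F ;
  laurentP : `[< exists N, lbound lcoef N >] }.

HB.instance Definition _ := [isSub for lcoef].
HB.instance Definition _ := [Choice of laurent by <:].

Lemma lcoef_bound (f : laurent) : exists N, lbound f N.
Proof. by have /asboolP := laurentP f. Qed.

Lemma laurent_eq (f g : laurent) : (forall k, f k = g k) -> f = g.
Proof. by move=> e; apply/val_inj/funext. Qed.

Lemma lbound_cst0 : exists N, lbound (fun=> 0) N.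
Proof. by exists 0%N. Qed.

Lemma lbound_add (f g : laurent) : exists N, lbound (fun k => f k + g k) N.
Proof.
have [[N hN] [M hM]] := (lcoef_bound f, lcoef_bound g).
by exists (N + M)%N => k hk; rewrite hN ?hM ?addr0 //; lia.
Qed.

Lemma lbound_opp (f : laurent) : exists N, lbound (fun k => - f k) N.
Proof. by have [N hN] := lcoef_bound f; exists N => k /hN->; rewrite oppr0. Qed.

Definition lzero := Laurent (asboolT lbound_cst0).
Definition ladd f g := Laurent (asboolT (lbound_add f g)).
Definition lopp f := Laurent (asboolT (lbound_opp f)).

Lemma laddA : associative ladd.
Proof. by move=> f g h; apply: laurent_eq => k /=; rewrite addrA. Qed.
Lemma laddC : commutative ladd.
Proof. by move=> f g; apply: laurent_eq => k /=; rewrite addrC. Qed.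
Lemma ladd0 : left_id lzero ladd.
Proof. by move=> f; apply: laurent_eq => k /=; rewrite add0r. Qed.
Lemma laddN : left_inverse lzero lopp ladd.
Proof. by move=> f; apply: laurent_eq => k /=; rewrite addNr. Qed.

HB.instance Definition _ := GRing.isZmodule.Build laurent laddA laddC ladd0 laddN.

(* the sum has finite support as soon as a and b are bounded below *)
Definition lconv a b : int -> F :=
  fun k => \sum_(i \in [set: int]) a i * b (k - i).

Lemma lconvE a b N M k : lbound a N -> lbound b M ->
  lconv a b (k%:Z - N%:Z - M%:Z) =
    \sum_(j < k.+1) a (j%:Z - N%:Z) * b ((k - j)%N%:Z - M%:Z).
Proof.
move=> ha hb; rewrite /lconv.
pose r := [seq j%:Z - N%:Z | j <- iota 0 k.+1].
have ur : uniq r.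
  by rewrite map_inj_uniq ?iota_uniq// => i j /=; lia.
rewrite (fsbigE r)//; last first.
  move=> i0 _; pose i : int := i0; rewrite -[i0]/i => nir.
  have [ilt|ige] := ltrP i (- N%:Z); first by rewrite ha// mul0r.
  rewrite (hb (_ - _)) ?mulr0//; rewrite ltNge; apply: contra nir => h.
  apply/mapP; exists ((absz (i + N%:Z)%R)); last by lia.
  by rewrite mem_iota; lia.
rewrite big_mkcond /= big_map -[iota 0 k.+1]/(index_iota 0 k.+1) big_mkord.
apply: eq_bigr => j _; rewrite in_setT; congr (_ * b _).
by have := ltn_ord j; lia.
Qed.

Lemma lconv0 a b N M : lbound a N -> lbound b M -> lbound (lconv a b) (N + M).
Proof.
move=> ha hb k hk; rewrite /lconv fsbig1// => i _.
have [ilt|ige] := ltrP i (- N%:Z); first by rewrite ha// mul0r.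
by rewrite (hb (_ - _)) ?mulr0//; lia.
Qed.

Lemma lbound_conv (f g : laurent) : exists N, lbound (lconv f g) N.
Proof.
have [[N hN] [M hM]] := (lcoef_bound f, lcoef_bound g).
by exists (N + M)%N; exact: lconv0.
Qed.

Definition lmul f g := Laurent (asboolT (lbound_conv f g)).

Definition trunc a N L : {poly F} := \poly_(i < L) a (i%:Z - N%:Z).

Lemma lconv_trunc a b N M k L : lbound a N -> lbound b M -> (k < L)%N ->
  lconv a b (k%:Z - N%:Z - M%:Z) = (trunc a N L * trunc b M L)`_k.
Proof.
move=> ha hb kL; rewrite lconvE// coefM; apply: eq_bigr => j _.
have := ltn_ord j; rewrite /trunc !coef_poly => jk.
by rewrite !ifT//; lia.
Qed.

Lemma coefMl_eq (p q r : {poly F}) k :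
  (forall j, (j <= k)%N -> p`_j = q`_j) -> (r * p)`_k = (r * q)`_k.
Proof. by move=> e; rewrite !coefM; apply: eq_bigr => j _; rewrite e// leq_subr. Qed.

Lemma lconv_eq0 a b N M k : lbound a N -> lbound b M ->
  k < - N%:Z - M%:Z -> lconv a b k = 0.
Proof. by move=> ha hb hk; rewrite (lconv0 ha hb)//; lia. Qed.

Lemma lmulC : commutative lmul.
Proof.
move=> f g; apply: laurent_eq => k /=.
have [[N hN] [M hM]] := (lcoef_bound f, lcoef_bound g).
have [hk|hk] := ltrP k (- N%:Z - M%:Z).
  by rewrite (lconv_eq0 hN hM)// (lconv_eq0 hM hN)//; lia.
pose m := absz (k + N%:Z + M%:Z)%R.
have -> : k = m%:Z - N%:Z - M%:Z by lia.
rewrite (lconv_trunc hN hM (leqnn _)).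
by rewrite [m%:Z - _ - _]addrAC (lconv_trunc hM hN (leqnn _)) mulrC.
Qed.

Lemma lmulA : associative lmul.
Proof.
move=> f g h; apply: laurent_eq => k /=.
have [N hN] := lcoef_bound f; have [M hM] := lcoef_bound g.
have [K hK] := lcoef_bound h.
have hMK := lconv0 hM hK; have hNM := lconv0 hN hM.
have [hk|hk] := ltrP k (- N%:Z - M%:Z - K%:Z).
  by rewrite (lconv_eq0 hN hMK)// ?(lconv_eq0 hNM hK)//; lia.
pose m := (absz (k + N%:Z + M%:Z + K%:Z)%R).
have -> : k = m%:Z - N%:Z - (M + K)%N%:Z by lia.
rewrite (lconv_trunc hN hMK (leqnn _)).
have -> : m%:Z - N%:Z - (M + K)%N%:Z = m%:Z - (N + M)%N%:Z - K%:Z by lia.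
rewrite (lconv_trunc hNM hK (leqnn _)).
rewrite (@coefMl_eq _ (trunc g M m.+1 * trunc h K m.+1)); last first.
  move=> j jm; rewrite coef_poly ltnS jm -(lconv_trunc hM hK)//.
  by congr lconv; lia.
rewrite mulrA ![_ * trunc h _ _]mulrC; apply: coefMl_eq => j jm.
rewrite [RHS]coef_poly ltnS jm -(lconv_trunc hN hM)//.
by congr lconv; lia.
Qed.

Definition lmono_fun (n : int) (c : F) : int -> F := fun k => if k == n then c else 0.
Lemma lmono_bound n c : exists N, lbound (lmono_fun n c) N.
Proof.
by exists (absz (n)%R) => k hk; rewrite /lmono_fun ifF//; apply/eqP; lia.
Qed.
Definition lmono n c := Laurent (asboolT (lmono_bound n c)).

Lemma lmonoM n c (f : laurent) k : lmul (lmono n c) f k = c * f (k - n).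
Proof.
rewrite /= /lconv (fsbigE [:: n])//; last first.
  by move=> i _; rewrite inE /lmono_fun => /negPf->; rewrite mul0r.
by rewrite big_mkcond/= big_seq1 in_setT /lmono_fun eqxx.
Qed.

Definition lone := lmono 0 1.

Lemma lmul1 : left_id lone lmul.
Proof. by move=> f; apply: laurent_eq => k; rewrite lmonoM mul1r subr0. Qed.

Lemma lmulDl : left_distributive lmul ladd.
Proof.
move=> f g h; apply: laurent_eq => k /=.
have [N hN] := lcoef_bound f; have [M hM] := lcoef_bound g.
have [K hK] := lcoef_bound h.
pose L := (N + M)%N.
have hf : lbound f L by move=> i hi; apply: hN; lia.
have hg : lbound g L by move=> i hi; apply: hM; lia.
have hfg : lbound (fun i => f i + g i) L by move=> i hi; rewrite hf// hg// addr0.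
have [hk|hk] := ltrP k (- L%:Z - K%:Z).
  by rewrite (lconv_eq0 hfg hK)// (lconv_eq0 hf hK)// (lconv_eq0 hg hK)// addr0.
have -> : k = (absz (k + L%:Z + K%:Z)%R)%:Z - L%:Z - K%:Z by lia.
rewrite !lconvE// -big_split; apply: eq_bigr => j _ /=.
by rewrite mulrDl.
Qed.

Lemma lone_neq0 : lone != 0.
Proof.
apply/eqP => /(congr1 (fun f : laurent => f 0)) /= /eqP.
by rewrite /lmono_fun eqxx oner_eq0.
Qed.

HB.instance Definition _ :=
  GRing.Zmodule_isComNzRing.Build laurent lmulA lmulC lmul1 lmulDl lone_neq0.

Definition linv (f : laurent) : laurent := xget 0 [set g | g * f = 1].

(* the coefficients of the inverse of the power series with coefficients s *)
Fixpoint invs (s : nat -> F) n : seq F :=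
  if n is m.+1 then
    rcons (invs s m)
      ((s 0%N)^-1 * ((m == 0%N)%:R - \sum_(i < m) (invs s m)`_i * s (m - i)%N))
  else [::].

Lemma size_invs s n : size (invs s n) = n.
Proof. by elim: n => //= n IH; rewrite size_rcons IH. Qed.

Lemma nth_invs s n i : (i < n)%N -> (invs s n)`_i = (invs s i.+1)`_i.
Proof.
elim: n => // n IH; rewrite ltnS leq_eqVlt => /predU1P[->//|lt_in].
by rewrite [LHS]/= nth_rcons size_invs lt_in IH.
Qed.

Lemma invsP s n : s 0%N != 0 ->
  \sum_(i < n.+1) (invs s i.+1)`_i * s (n - i)%N = (n == 0%N)%:R.
Proof.
move=> s0; rewrite big_ord_recr /= subnn nth_rcons size_invs ltnn eqxx.
rewrite mulrAC mulVf// mul1r addrC -addrA -[RHS]addr0; congr (_ + _).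
rewrite addrC; apply/eqP; rewrite subr_eq0; apply/eqP; apply: eq_bigr => i _.
by congr (_ * _); have := nth_invs s (ltn_ord i); rewrite /= => ->.
Qed.

Definition lseries_fun (s : nat -> F) : int -> F :=
  fun k => if k is Posz m then s m else 0.
Lemma lseries_bound0 s : lbound (lseries_fun s) 0.
Proof. by case. Qed.
Lemma lseries_bound s : exists N, lbound (lseries_fun s) N.
Proof. by exists 0%N; exact: lseries_bound0. Qed.
Definition lseries s := Laurent (asboolT (lseries_bound s)).

Lemma linvP (f : laurent) : f != 0 -> linv f * f = 1.
Proof.
move=> f0; rewrite /linv; apply: (@xgetPex _ 0 [set g | g * f = 1]).
have [N hN] := lcoef_bound f.
have exf : exists m, f (m%:Z - N%:Z) != 0.
  apply: contrapT => hn; move/eqP: f0; apply; apply: laurent_eq => k.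
  have [/hN//|hk] := ltrP k (- N%:Z).
  apply/eqP; apply/negPn/negP => fk; apply: hn; exists (absz (k + N%:Z)%R).
  by have -> : (absz (k + N%:Z)%R)%:Z - N%:Z = k by lia.
case: (ex_minnP exf) => m fm minm.
pose s (i : nat) := f (i%:Z + (m%:Z - N%:Z)).
have s0 : s 0%N != 0 by rewrite /s add0r.
have fE : f = lmono (m%:Z - N%:Z) 1 * lseries s.
  apply: laurent_eq => k; rewrite lmonoM mul1r /= /lseries_fun.
  case E: (_ - _) => [j|j]; first by congr (lcoef f); lia.
  have [/hN//|hk] := ltrP k (- N%:Z).
  apply/eqP; apply/negPn/negP => fk.
  have /minm : f ((absz (k + N%:Z)%R)%:Z - N%:Z) != 0.
    by have -> : (absz (k + N%:Z)%R)%:Z - N%:Z = k by lia.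
  by lia.
exists (lmono (N%:Z - m%:Z) 1 * lseries (fun j => (invs s j.+1)`_j)).
rewrite /= fE mulrACA.
have -> : lmono (N%:Z - m%:Z) 1 * lmono (m%:Z - N%:Z) 1 = 1.
  apply: laurent_eq => k; rewrite lmonoM mul1r /= /lmono_fun.
  by congr (if _ then _ else _); apply/eqP/eqP; lia.
rewrite mul1r; apply: laurent_eq => -[k|k]; last first.
  by rewrite /= (lconv_eq0 (lseries_bound0 _) (lseries_bound0 _)).
rewrite [LHS]/= -[k%:Z]subr0 -[k%:Z - 0]subr0.
rewrite (lconvE k (lseries_bound0 _) (lseries_bound0 _)) !subr0.
under eq_bigr do rewrite !subr0.
by rewrite /= (invsP k s0) /lmono_fun; case: k.
Qed.

Lemma linv0 : linv 0 = 0.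
Proof.
rewrite /linv; case: xgetP => // g _ /=; rewrite mulr0 => /eqP.
by rewrite eq_sym oner_eq0.
Qed.

HB.instance Definition _ := GRing.ComNzRing_isField.Build laurent linvP linv0.
End Laurent.

Section Expansions.
Variable F : fieldType.
Implicit Types (a : option F) (f : laurent F).
Local Notation laurent := (laurent F).

Definition lcst (c : F) : laurent := lmono 0 c.
Definition lX : laurent := lmono 1 1.

Definition lderiv_fun (f : laurent) : int -> F := fun k => f (k + 1) *~ (k + 1).
Lemma lderiv_bound f : exists N, lbound (lderiv_fun f) N.
Proof.
have [N hN] := lcoef_bound f; exists N.+1 => k hk.
by rewrite /lderiv_fun hN ?mul0rz//; lia.
Qed.
Definition lderiv f := Laurent (asboolT (lderiv_bound f)).

(* the primitive of f without its logarithmic term f_{-1} log u *)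
Definition lprim_fun (f : laurent) : int -> F :=
  fun k => if k == 0 then 0 else f (k - 1) / k%:~R.
Lemma lprim_bound f : exists N, lbound (lprim_fun f) N.
Proof.
have [N hN] := lcoef_bound f; exists N => k hk.
by rewrite /lprim_fun hN ?mul0r ?if_same//; lia.
Qed.
Definition lprim f := Laurent (asboolT (lprim_bound f)).

Definition lres (f : laurent) : F := f (-1).

(* The points of P^1 are Some c (c in F) and None (infinity). lx a is the affine
   coordinate x in terms of the local coordinate u at a: u = x - c at Some c,
   u = w = 1/x at None. Hence dx = (lderiv (lx a)) du. *)
Definition lx (a : option F) : laurent := if a is Some c then lcst c + lX else lX^-1.

Definition lpoly a (p : {poly F}) : laurent := (map_poly lcst p).[lx a].
Definition lexp a (r : {fraction {poly F}}) : laurent :=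
  lpoly a (\n_(repr r)) / lpoly a (\d_(repr r)).

(* A such that Om dx = A du at a *)
Definition lform a (Om : 'M[{fraction {poly F}}]_2) : 'M[laurent]_2 :=
  \matrix_(i, j) (lexp a (Om i j) * lderiv (lx a)).

Definition lser_mx (X : nat -> 'M[F]_2) : 'M[laurent]_2 :=
  \matrix_(i, j) lseries (fun s => X s i j).

Definition lgauge (M A : 'M[laurent]_2) : 'M[laurent]_2 :=
  invmx M *m map_mx lderiv M + invmx M *m A *m M.

Definition rgauge (M : 'M[{poly F}]_2) (Om : 'M[{fraction {poly F}}]_2) :=
  let Mf := map_mx (@tofrac _) M in
  invmx Mf *m map_mx (fun p => tofrac p^`()) M + invmx Mf *m Om *m Mf.

End Expansions.
Arguments lX {F}.

Definition mx2 (A : Type) (a b c d : A) : 'M[A]_2 :=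
  \matrix_(i, j) if i == 0 then (if j == 0 then a else b)
                 else (if j == 0 then c else d).

Definition diag2 (A : nmodType) (d : 'I_2 -> A) : 'M[A]_2 := diag_mx (\row_s d s).

(* Formal matrices F exp(-diag(lam_0, lam_1)), lam_s = fe_ser s + fe_log s * log u.
   Derivatives of such a matrix are of the form G exp(-diag(lam_0, lam_1)) with the
   same exponential factor, and are represented by G. *)
Section Delta.
Variables (C : numClosedFieldType) (V : normedModType C).

Record fexp := FExp {
  fe_mat : 'M[laurent C]_2 ;
  fe_ser : 'I_2 -> laurent C ;
  fe_log : 'I_2 -> C }.

Definition fe_deriv (psi : fexp) : 'M[laurent C]_2 :=
  map_mx (@lderiv C) (fe_mat psi)
  - fe_mat psi *m diag2 (fun s => lderiv (fe_ser psi s) + lcst (fe_log psi s) / lX).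

(* Derivative along v of a family of Laurent series in a fixed local coordinate u;
   insubd gives 0 if the family of derivatives has unbounded poles. *)
Definition ldelta (v : V) (L : V -> laurent C) (y : V) : laurent C :=
  insubd (0 : laurent C) (fun k : int => 'D_v (fun z => L z k : C) y : C).

Definition mdelta (v : V) (A : V -> 'M[laurent C]_2) (y : V) : 'M[laurent C]_2 :=
  \matrix_(i, j) ldelta v (fun z => A z i j) y.

(* Derivative along v, x being fixed, of a family of series in u = x - q, where the
   centre q : V -> C varies: v acts on u as - 'D_v q. *)
Definition mdelta_at (v : V) (q : V -> C) (A : V -> 'M[laurent C]_2) (y : V) :
    'M[laurent C]_2 :=
  mdelta v A y - map_mx (fun f => lcst ('D_v q y) * lderiv f) (A y).

(* delta(psi) psi^-1, for families with constant logarithmic coefficients fe_log *)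
Definition fe_delta_log (v : V) (psi : V -> fexp) (y : V) : 'M[laurent C]_2 :=
  (mdelta v (fun z => fe_mat (psi z)) y
   - fe_mat (psi y) *m diag2 (fun s => ldelta v (fun z => fe_ser (psi z) s) y))
  *m invmx (fe_mat (psi y)).

(* res Tr (delta(A) /\ B(delta)), delta(A) and B(delta) being evaluated at two vectors *)
Definition res_wedge (A1 B1 A2 B2 : 'M[laurent C]_2) : C :=
  lres (\tr (A1 *m B2 - B1 *m A2)).

(* (df /\ dg)(v1, v2) at y *)
Definition dwedge (f g : V -> C) (v1 v2 y : V) : C :=
  'D_v1 f y * 'D_v2 g y - 'D_v2 f y * 'D_v1 g y.

End Delta.

Section Setting.
Variables (C : numClosedFieldType) (nu : nat).
(* The index set I is option 'I_nu, with None for infinity; t and theta are indexed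
   from 0. In th i s l, s = 0 stands for the sign + and s = 1 for the sign -. *)
Variables (m : option 'I_nu -> nat) (t : 'I_nu -> C).
Variable th : option 'I_nu -> 'I_2 -> nat -> C.

Definition ntot : nat := (\sum_i m i)%N.
Definition nq : nat := (ntot - 3)%N.

(* Ordered points ((q_j)_j, (p_j)_j): the q_j being distinct, this is an etale
   cover of the space of unordered ones. *)
Definition Pt := ('rV[C]_nq * 'rV[C]_nq)%type.
Definition qc (y : Pt) (j : 'I_nq) : C := y.1 0 j.
Definition pc (y : Pt) (j : 'I_nq) : C := y.2 0 j.

Definition in_Tt : Prop :=
  [/\ injective t, forall i : 'I_nu, i = 0%N :> nat -> t i = 0 &
      forall i : 'I_nu, i = 1%N :> nat -> t i = 1].

Definition exponents_ok : Prop :=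
  [/\ forall i, (1 < m i)%N -> th i 0 0%N != th i 1 0%N,
      forall i, m i = 1%N -> forall z : int, th i 0 0%N - th i 1 0%N != z%:~R &
      \sum_i (th i 0 (m i).-1 + th i 1 (m i).-1) = -1].

Definition Mt (y : Pt) : Prop :=
  injective (qc y) /\ (forall j i, qc y j != t i).

Definition pt (i : option 'I_nu) : option C := omap t i.

Definition Ppol : {poly C} := \prod_i ('X - (t i)%:P) ^+ m (Some i).

Local Notation "p %:F" := (tofrac p) : ring_scope.

Definition c0 (y : Pt) (Cf : 'I_nu -> {poly C}) (Ctil Cinf : {poly C}) :
    {fraction {poly C}} :=
  \sum_i (Cf i)%:F / (('X - (t i)%:P) ^+ m (Some i))%:F
  + \sum_j (pc y j)%:P%:F / ('X - (qc y j)%:P)%:F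
  + Ctil%:F + ('X^(nq) * Cinf)%:F.

Definition d0 (y : Pt) (Df : 'I_nu -> {poly C}) (Dinf : {poly C}) :
    {fraction {poly C}} :=
  \sum_i (Df i)%:F / (('X - (t i)%:P) ^+ m (Some i))%:F
  - \sum_j ('X - (qc y j)%:P)%:F^-1 + Dinf%:F.

Definition normal_shape (y : Pt) (Om : 'M[{fraction {poly C}}]_2) : Prop :=
  exists (Cf Df : 'I_nu -> {poly C}) (Ctil Cinf Dinf : {poly C}),
    [/\ forall i, (size (Cf i) <= m (Some i))%N /\ (size (Df i) <= m (Some i))%N,
        (size Cinf <= m None)%N, (size Dinf <= (m None).-1)%N,
        (size Ctil <= nq)%N &
        Om = mx2 0 (Ppol%:F^-1) (c0 y Cf Ctil Cinf) (d0 y Df Dinf)].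

Definition Phit (y : Pt) (j : 'I_nq) : 'M[{poly C}]_2 :=
  mx2 1 0 (pc y j)%:P ('X - (qc y j)%:P).

Definition apparent (y : Pt) (Om : 'M[{fraction {poly C}}]_2) : Prop :=
  forall j a b (k : int), k < 0 ->
    lexp (Some (qc y j)) (rgauge (Phit y j) Om a b) k = 0.

Definition Gmx (k : nat) : 'M[{poly C}]_2 := mx2 1 0 0 'X^k.

(* matrix of the connection at t_i with respect to the local coordinate, in the
   trivialization over U_infty if i = infty *)
Definition conn_at (i : option 'I_nu) (Om : 'M[{fraction {poly C}}]_2) :
    'M[laurent C]_2 :=
  lform (pt i) (if i is Some _ then Om else rgauge (Gmx (ntot - 2)) Om).

Definition has_formal_data (i : option 'I_nu) (A : 'M[laurent C]_2) : Prop :=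
  exists2 M : nat -> 'M[C]_2, M 0%N \in unitmx &
    lgauge (lser_mx M) A =
    diag2 (fun s => \sum_(l < m i) lcst (th i s l) * lX ^+ l / lX ^+ m i).

Definition normal_form (y : Pt) (Om : 'M[{fraction {poly C}}]_2) : Prop :=
  [/\ normal_shape y Om, apparent y Om &
      forall i, has_formal_data i (conn_at i Om)].

Definition lmx_cst (M : 'M[C]_2) : 'M[laurent C]_2 := map_mx (@lcst C) M.

Definition compatible_framing i (Phi : 'M[C]_2) (Om : 'M[{fraction {poly C}}]_2) :=
  Phi \in unitmx /\
  (\matrix_(a, b)
     (invmx (lmx_cst Phi) *m conn_at i Om *m lmx_cst Phi) a b (- (m i)%:Z))
  = diag2 (fun s => th i s 0%N).

(* Phi Xi exp(- Lambda), dLambda = diag_s (\sum_l TH s l u^(l - m i)) du *)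
Definition psi_t i (Phi : 'M[C]_2) (Xi : nat -> 'M[C]_2) (TH : 'I_2 -> nat -> C) :
    fexp C :=
  let dLam s := lseries (TH s) / lX ^+ m i in
  FExp (lmx_cst Phi *m lser_mx Xi) (fun s => lprim (dLam s)) (fun s => lres (dLam s)).

Definition formal_solution i (Phi : 'M[C]_2) (Om : 'M[{fraction {poly C}}]_2)
    (Xi : nat -> 'M[C]_2) (TH : 'I_2 -> nat -> C) : Prop :=
  [/\ Xi 0%N = 1%:M,
      forall s, (0 < s)%N -> forall a, Xi s a a = 0,
      forall s l, (l < m i)%N -> TH s l = th i s l &
      let psi := psi_t i Phi Xi TH in
      fe_deriv psi + conn_at i Om *m fe_mat psi = 0].

Definition psi_q (y : Pt) (j : 'I_nq) (Xi : nat -> 'M[C]_2) : 'M[laurent C]_2 :=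
  lmx_cst (mx2 1 0 (pc y j) 1) *m lser_mx Xi *m mx2 1 0 0 lX.

Definition solution_q (y : Pt) (j : 'I_nq) (Om : 'M[{fraction {poly C}}]_2)
    (Xi : nat -> 'M[C]_2) : Prop :=
  [/\ Xi 0%N = 1%:M,
      exists r K : C, 0 < r /\ (forall s a b, `|Xi s a b| * r ^+ s <= K) &
      let psi := psi_q y j Xi in
      map_mx (@lderiv C) psi + lform (Some (qc y j)) Om *m psi = 0].

Definition omega (Om : Pt -> 'M[{fraction {poly C}}]_2)
    (psit : option 'I_nu -> Pt -> fexp C) (psiq : 'I_nq -> Pt -> 'M[laurent C]_2)
    (v1 v2 y : Pt) : C :=
  let dA i v := mdelta v (fun z => conn_at i (Om z)) y in
  let dP i v := fe_delta_log v (psit i) y in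
  let q j := fun z => qc z j in
  let dAq j v := mdelta_at v (q j) (fun z => lform (Some (qc z j)) (Om z)) y in
  let dPq j v := mdelta_at v (q j) (psiq j) y *m invmx (psiq j y) in
  2^-1 * (\sum_i res_wedge (dA i v1) (dP i v1) (dA i v2) (dP i v2))
  + 2^-1 * (\sum_j res_wedge (dAq j v1) (dPq j v1) (dAq j v2) (dPq j v2)).

End Setting.

Definition CC (R : realType) : numClosedFieldType := R[i]%C.

(* Main.v *)
Require Import Defs.
From HB Require Import structures.
From mathcomp Require Import all_boot all_order all_algebra.
From mathcomp Require Import zify ring fraction generic_quotient.
From mathcomp Require Import boolp classical_sets functions fsbigop.
From mathcomp Require Import reals topology normedtype derive.

Set Implicit Arguments.
Unset Strict Implicit.
Unset Printing Implicit Defensive.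
Import Order.TTheory GRing.Theory Num.Theory.
Import numFieldNormedType.Exports.
Local Open Scope ring_scope.

(* At t_i the trace and the determinant of the connection matrix fix all the polar parts,
   since the entry (0, 0) vanishes and the entry (0, 1) has a fixed leading term; hence
   delta(Omega) and delta(psi) psi^-1 are holomorphic there and the residue is 0.

   At q = q_j write u = x - q and W for the connection matrix. Since psi' = - W psi,
   delta(psi) psi^-1 = M + (delta q) W and delta(Omega) = dot W - (delta q) W', where M
   and dot W are computed at fixed u and M is holomorphic. The residue of the wedge
   then collapses to 2 dg /\ dq, where g is the entry (1, 1) of the first coefficient of
   Xi_q. The differential equation gives g = p / P(q) - r_j, where r_j is the constant
   term of d_0 at q_j. Finally r_j = F(q_j) - sum_(k != j) 1 / (q_j - q_k), the rational
   function F being independent of the point, because its polar parts at the t_i and its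
   order at infinity are; so sum_j dr_j /\ dq_j = 0 by symmetry. *)

(** * Orders and lowest coefficients of Laurent series *)

Section LaurentOrder.
Variable F : fieldType.
Implicit Types (f g : laurent F) (a b k : int).

(** Only a lower bound for the order of f, so that 0 satisfies it for every a and sums preserve
    it. *)
Definition lorder_ge a f := forall k, k < a -> f k = 0.

Lemma lcoefD f g k : (f + g) k = f k + g k. Proof. by []. Qed.
Lemma lcoefN f k : (- f) k = - f k. Proof. by []. Qed.
Lemma lcoefB f g k : (f - g) k = f k - g k. Proof. by []. Qed.
Lemma lcoef0 k : (0 : laurent F) k = 0. Proof. by []. Qed.

Lemma lcoef_sum I (r : seq I) (P : pred I) (G : I -> laurent F) k :
  (\sum_(i <- r | P i) G i) k = \sum_(i <- r | P i) G i k.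
Proof. by apply: (big_morph (fun f : laurent F => f k)). Qed.

Lemma lorder_geE a f k : lorder_ge a f -> k < a -> f k = 0.
Proof. exact. Qed.

Lemma lorder_geW a b f : b <= a -> lorder_ge a f -> lorder_ge b f.
Proof. by move=> ba h k kb; apply: h; apply: lt_le_trans ba. Qed.

Lemma lorder_geD a f g : lorder_ge a f -> lorder_ge a g -> lorder_ge a (f + g).
Proof. by move=> hf hg k ka; rewrite lcoefD hf// hg// addr0. Qed.

Lemma lorder_geN a f : lorder_ge a f -> lorder_ge a (- f).
Proof. by move=> hf k ka; rewrite lcoefN hf// oppr0. Qed.

Lemma lorder_geB a f g : lorder_ge a f -> lorder_ge a g -> lorder_ge a (f - g).
Proof. by move=> hf hg; apply/lorder_geD => //; exact: lorder_geN. Qed.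

Lemma lorder_ge_sum a I (r : seq I) (P : pred I) (G : I -> laurent F) :
  (forall i, P i -> lorder_ge a (G i)) -> lorder_ge a (\sum_(i <- r | P i) G i).
Proof. by move=> h; elim/big_rec: _ => // i x Pi; apply: lorder_geD; exact: h. Qed.

(** The factors vanish below a and b, so the convolution is a finite sum; n is the distance to the
    lowest possible exponent a + b. The cases n = 0 and n = 1 serve for the residues. *)
Lemma lcoefM_conv a b (n : nat) f g : lorder_ge a f -> lorder_ge b g ->
  (f * g) (a + b + n%:Z) = \sum_(j < n.+1) f (a + j%:Z) * g (b + (n - j)%N%:Z).
Proof.
move=> ha hb; rewrite [LHS]/= /lconv.
pose r := [seq a + j%:Z | j <- iota 0 n.+1].
have ur : uniq r by rewrite map_inj_uniq ?iota_uniq// => i j /=; lia.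
rewrite (fsbigE r)//; last first.
  move=> i0 _; pose i : int := i0; rewrite -[i0]/i => nir.
  have [ilt|ige] := ltrP i a; first by rewrite ha// mul0r.
  rewrite (hb (_ - _)) ?mulr0//; rewrite ltNge; apply: contra nir => h.
  apply/mapP; exists ((absz (i - a)%R)); last by lia.
  by rewrite mem_iota; lia.
rewrite big_mkcond /= big_map -[iota 0 n.+1]/(index_iota 0 n.+1) big_mkord.
apply: eq_bigr => j _; rewrite in_setT; congr (_ * lcoef _ _).
by have := ltn_ord j; lia.
Qed.

Lemma lorder_geM a b f g :
  lorder_ge a f -> lorder_ge b g -> lorder_ge (a + b) (f * g).
Proof.
move=> ha hb k hk; rewrite [LHS]/= /lconv fsbig1// => i _.
have [ilt|ige] := ltrP i a; first by rewrite ha// mul0r.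
by rewrite (hb (_ - _)) ?mulr0//; lia.
Qed.

Lemma lcoefM0 a b f g : lorder_ge a f -> lorder_ge b g ->
  (f * g) (a + b) = f a * g b.
Proof.
move=> ha hb; have := lcoefM_conv 0 ha hb.
by rewrite addr0 big_ord1 !addr0.
Qed.

Lemma lcoefM1 a b f g : lorder_ge a f -> lorder_ge b g ->
  (f * g) (a + b + 1) = f a * g (b + 1) + f (a + 1) * g b.
Proof.
move=> ha hb; have := lcoefM_conv 1 ha hb.
by rewrite big_ord_recl big_ord1 /= !addr0.
Qed.

Lemma lorder_ge_cst c : lorder_ge 0 (lcst c : laurent F).
Proof. by move=> k k0; rewrite /= /lmono_fun ifF//; lia. Qed.

Lemma lcoef_cst c : (lcst c : laurent F) 0 = c.
Proof. by rewrite /= /lmono_fun eqxx. Qed.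

Lemma lcoef_cstM c f k : (lcst c * f) k = c * f k.
Proof. by rewrite -[k in RHS]subr0; exact: lmonoM. Qed.

Lemma lcoef_monoM n c f k : (lmono n c * f) k = c * f (k - n).
Proof. exact: lmonoM. Qed.

Lemma lcoef_XM f k : (lX * f) k = f (k - 1).
Proof. by rewrite -[RHS]mul1r; exact: lmonoM. Qed.

Lemma lmono1M n k : lmono n 1 * lmono k 1 = lmono (n + k) 1 :> laurent F.
Proof.
apply: laurent_eq => l; rewrite lcoef_monoM mul1r /= /lmono_fun.
by congr (if _ then _ else _); apply/eqP/eqP; lia.
Qed.

Lemma lXn n : lX ^+ n = lmono n%:Z 1 :> laurent F.
Proof. by elim: n => // n IH; rewrite exprS IH lmono1M -intS. Qed.

Lemma lmonoV n : (lmono n 1)^-1 = lmono (- n) 1 :> laurent F.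
Proof.
have h : lmono n 1 * lmono (- n) 1 = 1 :> laurent F by rewrite lmono1M addrN.
by rewrite -[LHS]mulr1 -h mulKf//; apply: contra_eq_neq h => ->; rewrite mul0r eq_sym oner_eq0.
Qed.

Lemma lXnV n : lX ^- n = lmono (- n%:Z) 1 :> laurent F.
Proof. by rewrite lXn lmonoV. Qed.

Lemma lXV : lX^-1 = lmono (-1) 1 :> laurent F.
Proof. exact: lmonoV. Qed.

Lemma lorder_ge_mono n c : lorder_ge n (lmono n c : laurent F).
Proof. by move=> k k0; rewrite /= /lmono_fun ifF//; lia. Qed.

Lemma lcoef_mono n c k : (lmono n c : laurent F) k = if k == n then c else 0.
Proof. by []. Qed.

Lemma lorder_neq0 a f : f a != 0 -> f != 0.
Proof. by apply: contra_neq => ->. Qed.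

(** In f * f^-1 = 1 the product of the two lowest nonzero coefficients is itself a nonzero
    coefficient, so the two exponents must add up to 0. *)
Lemma lorderV a f : lorder_ge a f -> f a != 0 ->
  lorder_ge (- a) f^-1 /\ f^-1 (- a) = (f a)^-1.
Proof.
move=> hf fa; have f0 := lorder_neq0 fa.
have fV0 : f^-1 != 0 by rewrite invr_eq0.
have [N hN] := lcoef_bound f^-1.
(* Exponents are shifted by the pole bound N, so that the lowest nonzero one is a minimum over the
   naturals. *)
have exf : exists m, f^-1 (m%:Z - N%:Z) != 0.
  apply: contrapT => hn; move/eqP: fV0; apply; apply: laurent_eq => k.
  have [/hN//|hk] := ltrP k (- N%:Z).
  apply/eqP; apply/negPn/negP => fk; apply: hn; exists (absz (k + N%:Z)%R).
  by have -> : (absz (k + N%:Z)%R)%:Z - N%:Z = k by lia.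
case: (ex_minnP exf) => m fm minm.
have hb : lorder_ge (m%:Z - N%:Z) f^-1.
  move=> k hk; have [/hN//|hk'] := ltrP k (- N%:Z).
  apply/eqP; apply/negPn/negP => fk.
  have /minm : f^-1 ((absz (k + N%:Z)%R)%:Z - N%:Z) != 0.
    by have -> : (absz (k + N%:Z)%R)%:Z - N%:Z = k by lia.
  by lia.
have := lcoefM0 hf hb; rewrite mulfV// => e.
have ab : a + (m%:Z - N%:Z) = 0.
  apply/eqP; apply: contraT => /negPf ab.
  move/eqP: e; rewrite [X in X == _]/= /lmono_fun ab eq_sym.
  by rewrite mulf_eq0 (negPf fa) (negPf fm).
have mE : - a = m%:Z - N%:Z by lia.
rewrite mE; split=> //.
by move: e; rewrite ab [X in X = _]lcoef_cst => e; rewrite -[LHS](mulKf fa) -e mulr1.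
Qed.

Lemma lderivE f k : lderiv f k = f (k + 1) *~ (k + 1).
Proof. by []. Qed.

Lemma lorder_ge_deriv a f : lorder_ge a f -> lorder_ge (a - 1) (lderiv f).
Proof. by move=> h k ka; rewrite lderivE h ?mul0rz//; lia. Qed.

(** Sharper than [lorder_ge_deriv] at a = 0: the constant term has derivative 0, so no pole is
    created. *)
Lemma lorder_ge_deriv0 f : lorder_ge 0 f -> lorder_ge 0 (lderiv f).
Proof.
move=> h k k0; rewrite lderivE; have [->|k1] := eqVneq k (-1).
  by rewrite addNr mulr0z.
by rewrite h ?mul0rz//; lia.
Qed.

Lemma lderiv_mono n : lderiv (lmono n 1) = lmono (n - 1) n%:~R :> laurent F.
Proof.
apply: laurent_eq => k; rewrite lderivE !lcoef_mono.
have -> : (k == n - 1) = (k + 1 == n) by apply/eqP/eqP; lia.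
by case: eqP => [->|_]; rewrite ?mul0rz.
Qed.

Lemma lcoef_series s n : (lseries s : laurent F) n%:Z = s n.
Proof. by []. Qed.

Lemma lorder_ge_series s : lorder_ge 0 (lseries s : laurent F).
Proof. by case. Qed.

End LaurentOrder.

Arguments lorder_ge_mono {F} n c.
Arguments lorder_ge_cst {F} c.
Arguments lorder_ge_series {F} s.
Arguments lcoef : simpl never.

(** * Expansions of rational functions at the points of the projective line *)

Lemma fraction_numden (R : idomainType) (r : {fraction R}) :
  r = tofrac \n_(repr r) / tofrac \d_(repr r).
Proof.
set x := repr r; have d0 := denom_ratioP x.
apply: (@mulIf _ (tofrac \d_x)); first by rewrite tofrac_eq0.
rewrite mulfVK ?tofrac_eq0// -[r]reprK -/x; unlock tofrac.
rewrite -[LHS]FracField.pi_mul; apply/eqmodP.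
rewrite /= /FracField.equivf /FracField.mulf.
rewrite !numden_Ratio ?mulr1 ?oner_eq0//.
by rewrite mulrC.
Qed.

Section LaurentExpansion.
Variable F : fieldType.
Implicit Types (f g : laurent F) (p q : {poly F}) (c : F) (a : option F).
Implicit Types r : {fraction {poly F}}.

Lemma lcst_is_zmod_morphism : zmod_morphism (@lcst F).
Proof.
move=> x y; apply: laurent_eq => k; rewrite lcoefB !lcoef_mono.
by case: eqP; rewrite ?subr0.
Qed.

Lemma lcst_is_monoid_morphism : monoid_morphism (@lcst F).
Proof.
split=> // x y; apply: laurent_eq => k; rewrite lcoef_cstM !lcoef_mono.
by case: eqP; rewrite ?mulr0.
Qed.

HB.instance Definition _ :=
  GRing.isZmodMorphism.Build F (laurent F) (@lcst F) lcst_is_zmod_morphism.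
HB.instance Definition _ :=
  GRing.isMonoidMorphism.Build F (laurent F) (@lcst F) lcst_is_monoid_morphism.

Lemma lpoly_is_zmod_morphism a : zmod_morphism (@lpoly F a).
Proof. by move=> p q; rewrite /lpoly rmorphB hornerD hornerN. Qed.

Lemma lpoly_is_monoid_morphism a : monoid_morphism (@lpoly F a).
Proof. by split=> [|p q]; rewrite /lpoly ?rmorph1 ?hornerC// rmorphM hornerM. Qed.

HB.instance Definition _ a :=
  GRing.isZmodMorphism.Build {poly F} (laurent F) (@lpoly F a)
    (lpoly_is_zmod_morphism a).
HB.instance Definition _ a :=
  GRing.isMonoidMorphism.Build {poly F} (laurent F) (@lpoly F a)
    (lpoly_is_monoid_morphism a).

Lemma lpolyM a p q : lpoly a (p * q) = lpoly a p * lpoly a q.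
Proof. exact: rmorphM. Qed.

Lemma lpolyD a p q : lpoly a (p + q) = lpoly a p + lpoly a q.
Proof. exact: rmorphD. Qed.

Lemma lpolyN a p : lpoly a (- p) = - lpoly a p.
Proof. exact: rmorphN. Qed.

Lemma lpolyC a c : lpoly a c%:P = lcst c.
Proof. by rewrite /lpoly map_polyC hornerC. Qed.

Lemma lpolyX a : lpoly a 'X = lx a.
Proof. by rewrite /lpoly map_polyX hornerX. Qed.

Lemma lpoly_some c p :
  lorder_ge 0 (lpoly (Some c) p) /\ lpoly (Some c) p 0 = p.[c].
Proof.
elim/poly_ind: p => [|p d [h0 h1]]; first by rewrite rmorph0 horner0.
rewrite rmorphD rmorphM /= lpolyX lpolyC /= mulrDr hornerMXaddC.
have hX := lorder_ge_mono 1 (1 : F).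
split.
  apply: lorder_geD; last exact: lorder_ge_cst.
  apply: lorder_geD; rewrite mulrC.
    by rewrite -[0]addr0; apply: lorder_geM => //; apply: lorder_ge_cst.
  by apply: (@lorder_geW _ (1 + 0)) => //; exact: lorder_geM.
rewrite !lcoefD lcoef_cst [_ * lcst c]mulrC lcoef_cstM h1 [_ * lX]mulrC lcoef_XM.
by rewrite h0// addr0 mulrC.
Qed.

Lemma lpoly_XsubC c : lpoly (Some c) ('X - c%:P) = lX.
Proof. by rewrite rmorphB /= lpolyX lpolyC addrC addKr. Qed.

Lemma lpoly_some_order c p k q : p = q * ('X - c%:P) ^+ k ->
  lorder_ge k%:Z (lpoly (Some c) p) /\ lpoly (Some c) p k%:Z = q.[c].
Proof.
move=> ->; rewrite rmorphM rmorphXn /= lpoly_XsubC lXn mulrC.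
have [h0 h1] := lpoly_some c q.
split; last by rewrite lcoef_monoM subrr mul1r h1.
by rewrite -[X in lorder_ge X]addr0; apply: lorder_geM => //; apply: lorder_ge_mono.
Qed.

(** As x = 1/u at infinity, the degree becomes the order of the pole. For p = 0 the predecessor of
    the size and the leading coefficient are both 0, and the claims persist. *)
Lemma lpoly_none p :
  lorder_ge (- (size p).-1%:Z) (lpoly None p) /\
  lpoly None p (- (size p).-1%:Z) = lead_coef p.
Proof.
have lE : lpoly None p = \sum_(i < size p) lmono (- i%:Z) p`_i.
  rewrite /lpoly horner_coef size_map_poly; apply: eq_bigr => i _.
  rewrite coef_map /= exprVn lXnV; apply: laurent_eq => k.
  rewrite lcoef_cstM !lcoef_mono.
  by case: eqP => _; rewrite ?mulr1 ?mulr0.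
rewrite lE; split.
  apply: lorder_ge_sum => i _; apply: lorder_geW (lorder_ge_mono _ _).
  by have := ltn_ord i; lia.
rewrite lcoef_sum lead_coefE.
case E: (size p) => [|n]; first by rewrite big_ord0 nth_default// E.
rewrite big_ord_recr /= lcoef_mono eqxx big1 ?add0r// => i _.
by rewrite lcoef_mono ifF//; apply/eqP; have := ltn_ord i; lia.
Qed.

(** The lowest coefficient is nonzero: at c it is the value of the cofactor of the maximal power of
    X - c, at infinity the leading coefficient. *)
Lemma lpoly_neq0 a p : p != 0 -> lpoly a p != 0.
Proof.
move=> p0; case: a => [c|]; last first.
  apply: (@lorder_neq0 _ (- (size p).-1%:Z)).
  by rewrite (lpoly_none p).2 lead_coef_eq0.
have [k [q]] := multiplicity_XsubC p c; rewrite p0 /= => qc /lpoly_some_order[_ e].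
by apply: (@lorder_neq0 _ k%:Z); rewrite e.
Qed.


(** [lexp] is defined through a chosen representative of the fraction; cross multiplication shows
    that any other one gives the same expansion, which makes [lexp] a ring morphism. *)
Lemma lexpE a (n d : {poly F}) : d != 0 ->
  lexp a (tofrac n / tofrac d) = lpoly a n / lpoly a d.
Proof.
move=> d0; rewrite /lexp; set r := tofrac n / tofrac d.
have d'0 : \d_(repr r) != 0 by exact: denom_ratioP.
have /eqP := fraction_numden r; rewrite {1}/r eqr_div ?tofrac_eq0// -!tofracM.
rewrite tofrac_eq => /eqP/(congr1 (lpoly a)); rewrite !rmorphM => e.
by apply/eqP; rewrite eqr_div ?lpoly_neq0//= -e.
Qed.

Lemma fractionP r : exists n d : {poly F}, d != 0 /\ r = tofrac n / tofrac d.
Proof.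
by exists \n_(repr r), \d_(repr r); split; [exact: denom_ratioP|exact: fraction_numden].
Qed.

Lemma lexp_poly a p : lexp a (tofrac p) = lpoly a p.
Proof.
by rewrite -[tofrac p]divr1 -tofrac1 lexpE ?oner_eq0// rmorph1 divr1.
Qed.

Lemma lexp_is_zmod_morphism a : zmod_morphism (@lexp F a).
Proof.
move=> r1 r2; have [n1 [d1 [h1 ->]]] := fractionP r1.
have [n2 [d2 [h2 ->]]] := fractionP r2.
rewrite -[- (_ / _)]mulNr -rmorphN addf_div ?tofrac_eq0// -!tofracM -tofracD.
rewrite !lexpE ?mulf_neq0// lpolyD !lpolyM lpolyN.
rewrite -[- (lpoly a n2 / _)]mulNr.
by symmetry; apply: addf_div; exact: lpoly_neq0.
Qed.

Lemma lexp_is_monoid_morphism a : monoid_morphism (@lexp F a).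
Proof.
split=> [|r1 r2]; first by rewrite -tofrac1 lexp_poly rmorph1.
have [n1 [d1 [h1 ->]]] := fractionP r1; have [n2 [d2 [h2 ->]]] := fractionP r2.
rewrite mulf_div.
rewrite -!tofracM !lexpE ?mulf_neq0// !lpolyM.
by rewrite [RHS]mulf_div.
Qed.

HB.instance Definition _ a :=
  GRing.isZmodMorphism.Build {fraction {poly F}} (laurent F) (@lexp F a)
    (lexp_is_zmod_morphism a).
HB.instance Definition _ a :=
  GRing.isMonoidMorphism.Build {fraction {poly F}} (laurent F) (@lexp F a)
    (lexp_is_monoid_morphism a).

Lemma lexpV a r : lexp a r^-1 = (lexp a r)^-1.
Proof. exact: fmorphV. Qed.

Lemma lexpD a r s : lexp a (r + s) = lexp a r + lexp a s.
Proof. exact: rmorphD. Qed.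

Lemma lexpB a r s : lexp a (r - s) = lexp a r - lexp a s.
Proof. exact: rmorphB. Qed.

Lemma lexpM a r s : lexp a (r * s) = lexp a r * lexp a s.
Proof. exact: rmorphM. Qed.

Lemma lexp_sum a I (l : seq I) (Q : pred I) (G : I -> {fraction {poly F}}) :
  lexp a (\sum_(i <- l | Q i) G i) = \sum_(i <- l | Q i) lexp a (G i).
Proof. exact: rmorph_sum. Qed.

End LaurentExpansion.

(** * Two by two matrices, and holomorphic matrices of Laurent series *)

Lemma ord2P (i : 'I_2) : i = 0 \/ i = 1.
Proof. by case: i => -[|[|//]] h; [left|right]; apply: val_inj. Qed.

Section Mx2.
Variable R : comNzRingType.
Implicit Types M N : 'M[R]_2.

Lemma eq_mx2 M N : M 0 0 = N 0 0 -> M 0 1 = N 0 1 -> M 1 0 = N 1 0 ->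
  M 1 1 = N 1 1 -> M = N.
Proof. by move=> h1 h2 h3 h4; apply/matrixP => i j; case: (ord2P i) (ord2P j) => -> [] ->. Qed.

Lemma mulmx2E M N i j : (M *m N) i j = M i 0 * N 0 j + M i 1 * N 1 j.
Proof.
rewrite mxE big_ord_recl big_ord1; congr (_ + M i _ * N _ j); exact: val_inj.
Qed.

Lemma mxtrace2E M : \tr M = M 0 0 + M 1 1.
Proof.
rewrite /mxtrace big_ord_recl big_ord1; congr (_ + M _ _); exact: val_inj.
Qed.

Lemma det_mx2E M : \det M = M 0 0 * M 1 1 - M 0 1 * M 1 0.
Proof.
rewrite (expand_det_row M 0) big_ord_recl big_ord1 /cofactor !det_mx11 !mxE /=.
rewrite expr0 expr1 mul1r mulN1r mulrN; congr (_ * M _ _ - M _ _ * M _ _); exact: val_inj.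
Qed.

Lemma mx2_00 (a b c d : R) : mx2 a b c d 0 0 = a. Proof. by rewrite mxE. Qed.
Lemma mx2_01 (a b c d : R) : mx2 a b c d 0 1 = b. Proof. by rewrite mxE. Qed.
Lemma mx2_10 (a b c d : R) : mx2 a b c d 1 0 = c. Proof. by rewrite mxE. Qed.
Lemma mx2_11 (a b c d : R) : mx2 a b c d 1 1 = d. Proof. by rewrite mxE. Qed.
Definition mx2E := (mx2_00, mx2_01, mx2_10, mx2_11).

Lemma diag2E (d : 'I_2 -> R) i j : diag2 d i j = d i *+ (i == j).
Proof. by rewrite !mxE. Qed.

End Mx2.

Lemma invmx_unique (R : comUnitRingType) n (M N : 'M[R]_n) :
  M *m N = 1%:M -> invmx M = N.
Proof. by move=> e; have [uM _] := mulmx1_unit e; rewrite -[RHS](mulKmx uM) e mulmx1. Qed.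

Lemma mulmx2V (K : fieldType) (M : 'M[K]_2) (D := M 0 0 * M 1 1 - M 0 1 * M 1 0) :
  D != 0 -> M *m (D^-1 *: mx2 (M 1 1) (- M 0 1) (- M 1 0) (M 0 0)) = 1%:M.
Proof.
move=> D0; rewrite -scalemxAr; apply: eq_mx2; rewrite mxE mulmx2E !mx2E [RHS]mxE ?eqxx ?mulr1n;
  move: D0; rewrite /D; move: (M 0 0) (M 0 1) (M 1 0) (M 1 1) => x y z w D0 /=; field => //.
Qed.

Section HolomorphicMatrices.
Variable F : fieldType.
Implicit Types M N : 'M[laurent F]_2.

Definition mx_hol M := forall i j, lorder_ge 0 (M i j).

Lemma mx_holB M N : mx_hol M -> mx_hol N -> mx_hol (M - N).
Proof. by move=> hM hN i j; rewrite !mxE; apply: lorder_geB. Qed.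

Lemma mx_holM M N : mx_hol M -> mx_hol N -> mx_hol (M *m N).
Proof.
move=> hM hN i j; rewrite mxE; apply: lorder_ge_sum => k _.
by rewrite -[0]addr0; apply: lorder_geM.
Qed.

Lemma mx_hol_ser (X : nat -> 'M[F]_2) : mx_hol (lser_mx X).
Proof. by move=> i j; rewrite mxE; apply: lorder_ge_series. Qed.

Lemma mx_hol_deriv M : mx_hol M -> mx_hol (map_mx (@lderiv F) M).
Proof. by move=> h i j; rewrite mxE; apply: lorder_ge_deriv0. Qed.

(** The determinant of the series has constant term det X_0, a unit, so Cramer's formula gives an
    inverse without poles. *)
Lemma mx_hol_inv (X : nat -> 'M[F]_2) : X 0%N \in unitmx ->
  lser_mx X \in unitmx /\ mx_hol (invmx (lser_mx X)).
Proof.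
move=> uX; set S := lser_mx X; have hS : mx_hol S by exact: mx_hol_ser.
pose D := S 0 0 * S 1 1 - S 0 1 * S 1 0.
have hD : lorder_ge 0 D.
  by apply: lorder_geB; rewrite -[X in lorder_ge X]addr0; apply: lorder_geM.
have D0 : D 0 = \det (X 0%N).
  have M0 i j k l : (S i j * S k l) 0 = X 0%N i j * X 0%N k l.
    by rewrite -[in LHS](addr0 0) lcoefM0//; rewrite !mxE.
  by rewrite lcoefB !M0 det_mx2E.
have D00 : D 0 != 0 by rewrite D0 -unitfE -unitmxE.
have Dn : D != 0 := lorder_neq0 D00.
have [hV _] := lorderV hD D00; rewrite oppr0 in hV.
have e := mulmx2V Dn.
have [uS _] := mulmx1_unit e; split=> //; rewrite (invmx_unique e) => i j.
rewrite mxE -[X in lorder_ge X]addr0; apply: lorder_geM => //.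
by case: (ord2P i) => ->; case: (ord2P j) => ->; rewrite mx2E//; apply: lorder_geN.
Qed.

End HolomorphicMatrices.

(** * Polar parts determined by the formal data *)

Lemma gauge_invariants (F : fieldType) (X : nat -> 'M[F]_2) (A D : 'M[laurent F]_2) :
  X 0%N \in unitmx -> lgauge (lser_mx X) A = D ->
  exists H, [/\ mx_hol H, \tr A = \tr (D - H) & \det A = \det (D - H)].
Proof.
move=> /mx_hol_inv[uS hV] <-; set S := lser_mx X in uS hV *.
set H := invmx S *m map_mx (@lderiv F) S; exists H.
(* Removing the holomorphic term S^-1 S' leaves a conjugate of A, which has the trace and the
   determinant of A. *)
have -> : lgauge S A - H = invmx S *m A *m S by rewrite /lgauge addrAC subrr add0r.
split.
- by apply: mx_holM => //; apply/mx_hol_deriv/mx_hol_ser.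
- by rewrite mxtrace_mulC mulmxA mulmxV// mul1mx.
- by rewrite !det_mulmx mulrAC -det_mulmx mulVmx// det1 mul1r.
Qed.

(* The entry (0, 0) being 0, the trace gives the polar part of the entry (1, 1), and the
   determinant, up to order -n, that of the entry (1, 0). *)
Lemma gauge_polar_part (F : fieldType) (n : nat) (X X' : nat -> 'M[F]_2)
    (A A' D : 'M[laurent F]_2) :
  X 0%N \in unitmx -> X' 0%N \in unitmx ->
  lgauge (lser_mx X) A = D -> lgauge (lser_mx X') A' = D ->
  (forall i j, lorder_ge (- n%:Z) (D i j)) ->
  A 0 0 = 0 -> A' 0 0 = 0 -> A' 0 1 = A 0 1 ->
  lorder_ge (- n%:Z) (A 0 1) -> A 0 1 (- n%:Z) != 0 ->
  mx_hol (A - A').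
Proof.
move=> uX uX' eA eA' hD A00 A'00 A'01 hA01 nA01.
have [H [hH trH detH]] := gauge_invariants uX eA.
have [H' [hH' trH' detH']] := gauge_invariants uX' eA'.
have h11 : lorder_ge 0 (A 1 1 - A' 1 1).
  have -> : A 1 1 - A' 1 1 = (H' 0 0 + H' 1 1) - (H 0 0 + H 1 1).
    move: trH trH'; rewrite !mxtrace2E A00 A'00 !add0r => -> ->.
    rewrite !mxE; ring.
  by apply: lorder_geB; apply: lorder_geD.
have h10 : lorder_ge 0 (A 1 0 - A' 1 0).
  have [hV _] := lorderV hA01 nA01; rewrite opprK in hV.
  have n0 : - n%:Z <= 0 by lia.
  have D0 i j k l (G : 'M[laurent F]_2) : mx_hol G ->
      lorder_ge (- n%:Z) (D i j * G k l).
    by move=> hG; rewrite -[- n%:Z]addr0; apply: lorder_geM.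
  have H0 G G' i j k l : mx_hol G -> mx_hol G' ->
      lorder_ge (- n%:Z) (G i j * G' k l).
    by move=> hG hG'; apply: (lorder_geW n0); rewrite -[X in lorder_ge X]addr0; apply: lorder_geM.
  (* With A_00 = 0 the determinant is - A_01 A_10; dividing by A_01, of exact order -n, absorbs a
     pole of order at most n in the difference of the determinants. *)
  have -> : A 1 0 - A' 1 0 = (A 0 1)^-1 * (- (\det A - \det A')).
    by rewrite !det_mx2E A00 A'00 A'01; field; apply: lorder_neq0 nA01.
  rewrite -[X in lorder_ge X](subrr n%:Z); apply: lorder_geM => //.
  apply: lorder_geN; rewrite detH detH' !det_mx2E !mxE.
  (* The products of two entries of D cancel; every remaining term has at most one factor from D,
     hence a pole of order at most n. *)
  have -> : (D 0 0 - H 0 0) * (D 1 1 - H 1 1) - (D 0 1 - H 0 1) * (D 1 0 - H 1 0)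
     - ((D 0 0 - H' 0 0) * (D 1 1 - H' 1 1) - (D 0 1 - H' 0 1) * (D 1 0 - H' 1 0))
     = D 0 0 * (H' - H) 1 1 + D 1 1 * (H' - H) 0 0
       - (D 0 1 * (H' - H) 1 0 + D 1 0 * (H' - H) 0 1)
       + (H 0 0 * H 1 1 - H 0 1 * H 1 0 - (H' 0 0 * H' 1 1 - H' 0 1 * H' 1 0)).
    by rewrite !mxE; ring.
  have hB := mx_holB hH' hH.
  by apply: lorder_geD; [apply: lorder_geB; apply: lorder_geD; apply: D0|
                         apply: lorder_geB; apply: lorder_geB; apply: H0].
move=> i j; rewrite !mxE.
by case: (ord2P i) => ->; case: (ord2P j) => ->; rewrite ?A00 ?A'00 ?A'01 ?subrr.
Qed.

Lemma mx_hol_subE (F : fieldType) (A B : 'M[laurent F]_2) i j :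
  mx_hol (A - B) -> lorder_ge 0 (A i j - B i j).
Proof. by move=> /(_ i j); rewrite !mxE. Qed.

(** * Derivative of the coordinate, divisibility read off expansions, change of trivialization *)

Lemma lderiv_lx_some (F : fieldType) (c : F) : lderiv (lx (Some c)) = 1.
Proof.
apply: laurent_eq => k; rewrite lderivE lcoefD !lcoef_mono mulrzDl.
have -> : (k + 1 == 1) = (k == 0) by apply/eqP/eqP; lia.
case: (k =P 0) => [->|_]; first by rewrite add0r.
by rewrite mul0rz addr0; case: eqP => [->|_]; rewrite ?mulr0z ?mul0rz.
Qed.

Lemma lderiv_lx_none (F : fieldType) : lderiv (lx None) = - lmono (-2) 1 :> laurent F.
Proof.
rewrite /lx lXV lderiv_mono; apply: laurent_eq => k.
by rewrite lcoefN !lcoef_mono; case: eqP; rewrite ?oppr0.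
Qed.

Section Rational.
Variable (F : fieldType).
Implicit Types (p d : {poly F}) (c q : F) (a : option F).

Lemma lexp_XsubC_V_some c q : c != q ->
  lorder_ge 0 (lexp (Some c) (tofrac ('X - q%:P))^-1) /\
  lexp (Some c) (tofrac ('X - q%:P))^-1 0 = (c - q)^-1.
Proof.
move=> cq; rewrite lexpV lexp_poly; have [h0 h1] := lpoly_some c ('X - q%:P).
rewrite -[X in lorder_ge X]oppr0 -[X in lcoef _ X]oppr0.
rewrite hornerXsubC in h1; rewrite -h1; apply: lorderV => //.
by rewrite h1 subr_eq0.
Qed.

Lemma lexp_XsubC_V c : lexp (Some c) (tofrac ('X - c%:P))^-1 = lmono (-1) 1.
Proof. by rewrite lexpV lexp_poly lpoly_XsubC lXV. Qed.

Lemma lexp_XsubC_V_none (q : F) : lorder_ge 1 (lexp None (tofrac ('X - q%:P))^-1).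
Proof.
rewrite lexpV lexp_poly; have [h0 h1] := lpoly_none ('X - q%:P).
have [] := lorderV h0; first by rewrite h1 lead_coef_eq0 polyXsubC_eq0.
by rewrite opprK size_XsubC.
Qed.

(** If c had multiplicity l < k in p, the quotient would have a nonzero coefficient at the negative
    exponent l - k. *)
Lemma lexp_dvdp c k p d (q : {poly F}) : d = q * ('X - c%:P) ^+ k -> q.[c] != 0 ->
  lorder_ge 0 (lexp (Some c) (tofrac p / tofrac d)) -> ('X - c%:P) ^+ k %| p.
Proof.
move=> eq_d qc h; have [->|p0] := eqVneq p 0; first by rewrite dvdp0.
have d0 : d != 0.
  rewrite eq_d mulf_neq0 ?expf_neq0 ?polyXsubC_eq0//.
  by apply: contra_neq qc => ->; rewrite horner0.
have [l [r]] := multiplicity_XsubC p c; rewrite p0 /= => rc eq_p.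
have [hp p1] := lpoly_some_order eq_p; have [hd d1] := lpoly_some_order eq_d.
rewrite eq_p dvdp_mull// dvdp_exp2l// leqNgt; apply/negP => kl.
have [|hV V1] := lorderV hd; first by rewrite d1.
have := lcoefM0 hp hV; rewrite -lexpE// h; last by lia.
by move/esym/eqP; rewrite p1 V1 d1 mulf_eq0 invr_eq0 (negPf qc) orbF -rootE (negPf rc).
Qed.

End Rational.

Lemma rgauge_Gmx (F : fieldType) (k : nat) (a c d : {fraction {poly F}}) :
  rgauge (mx2 1 0 0 'X^k) (mx2 0 a c d) =
  mx2 0 (a * tofrac 'X^k) (c / tofrac 'X^k) (d + tofrac ('X^k)^`() / tofrac 'X^k).
Proof.
have Xk : tofrac 'X^k != 0 :> {fraction {poly F}}.
  by rewrite tofrac_eq0 expf_neq0 ?polyX_eq0.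
rewrite /rgauge; set G := map_mx _ _.
have GE : G = mx2 1 0 0 (tofrac 'X^k).
  by apply: eq_mx2; rewrite mxE !mx2E ?tofrac0 ?tofrac1.
have -> : invmx G = mx2 1 0 0 (tofrac 'X^k)^-1.
  apply: invmx_unique; rewrite GE; apply: eq_mx2; rewrite mulmx2E !mx2E [RHS]mxE;
    by rewrite ?eqxx ?mul0r ?mul1r ?mulr0 ?addr0 ?add0r ?divff.
have -> : map_mx (fun p : {poly F} => tofrac p^`()) (mx2 1 0 0 'X^k) =
    mx2 0 0 0 (tofrac ('X^k)^`()).
    by apply: eq_mx2; rewrite mxE !mx2E ?deriv0 -?[1]/(1%:P) ?derivC ?tofrac0.
rewrite GE; apply: eq_mx2; rewrite mxE !mulmx2E !mx2E
  ?(mul0r, mulr0, mul1r, mulr1, addr0, add0r)//.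
- by rewrite mulrC.
- by rewrite mulrAC mulVf// mul1r addrC [_^-1 * _]mulrC.
Qed.

(** * The polynomial P and the connection matrix at the points t_i *)

Section Setting.
Variables (C : numClosedFieldType) (nu : nat).
Variables (m : option 'I_nu -> nat) (t : 'I_nu -> C).
Variable th : option 'I_nu -> 'I_2 -> nat -> C.
Hypotheses (hnu : (2 <= nu)%N) (hm : forall i, (1 <= m i)%N) (tI : injective t).
Local Notation P := (Ppol m t).

Lemma Ppol_monic : P \is monic.
Proof. by apply: monic_prod => i _; rewrite monic_exp ?monicXsubC. Qed.

Lemma Ppol_neq0 : P != 0. Proof. exact: monic_neq0 Ppol_monic. Qed.

Lemma size_Ppol : (size P).-1 = (\sum_i m (Some i))%N.
Proof.
rewrite /Ppol size_prod => [|i _]; last by rewrite expf_neq0 ?polyXsubC_eq0.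
under eq_bigr do rewrite size_exp_XsubC -addn1.
rewrite big_split /= sum1_card.
by rewrite subSn ?leq_addl// addnK.
Qed.

Lemma ntotE : ntot m = (m None + \sum_i m (Some i))%N.
Proof.
have SI : injective (@Some 'I_nu) by move=> i j [].
rewrite /ntot (bigD1 None)//=; congr (_ + _)%N.
rewrite -[RHS](big_map Some predT) -[LHS]big_filter; apply/perm_big/uniq_perm.
- by rewrite filter_uniq ?index_enum_uniq.
- by rewrite (map_inj_uniq SI) index_enum_uniq.
move=> [i|]; rewrite mem_filter mem_index_enum andbT.
  by rewrite (mem_map SI) mem_index_enum.
by apply/esym/negP => /mapP[].
Qed.

Lemma ntot_ge3 : (3 <= ntot m)%N.
Proof.
rewrite ntotE; suff : (nu <= \sum_i m (Some i))%N by have := hm None; lia.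
by rewrite -[X in (X <= _)%N](card_ord nu) -sum1_card leq_sum.
Qed.

Lemma Ppol_horner_neq0 x : (forall i, x != t i) -> P.[x] != 0.
Proof.
move=> h; rewrite horner_prod prodf_seq_neq0; apply/allP => i _ /=.
by rewrite horner_exp hornerXsubC expf_neq0// subr_eq0.
Qed.

Lemma Ppol_factor i : exists2 q, P = q * ('X - (t i)%:P) ^+ m (Some i) & q.[t i] != 0.
Proof.
rewrite /Ppol (bigD1 i)//= mulrC; eexists; first by [].
rewrite horner_prod prodf_seq_neq0; apply/allP => k _ /=; apply/implyP => ki.
rewrite horner_exp hornerXsubC expf_neq0// subr_eq0; apply: contra ki => /eqP e.
by apply/eqP; apply: tI.
Qed.

(** The t_i being distinct, the prime powers in P are pairwise coprime, so the separate
    divisibilities multiply. *)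
Lemma Ppol_dvd (p : {poly C}) :
  (forall i, ('X - (t i)%:P) ^+ m (Some i) %| p) -> P %| p.
Proof.
move=> h; rewrite /Ppol -big_enum /=.
elim: (enum 'I_nu) (enum_uniq 'I_nu) => [|i s IH]; first by rewrite big_nil dvd1p.
rewrite cons_uniq => /andP[nis us]; rewrite big_cons Gauss_dvdp ?h ?IH//.
elim: s nis {IH us} => [|k s IH]; first by rewrite big_nil coprimep1.
rewrite inE negb_or => /andP[ik /IH hs]; rewrite big_cons coprimepMr hs andbT.
apply/coprimep_expl/coprimep_expr; rewrite coprimep_XsubC2// subr_eq0.
by apply: contra ik => /eqP/tI->.
Qed.

Lemma lexp_PpolV_some c : (forall i, c != t i) ->
  lorder_ge 0 (lexp (Some c) (tofrac P)^-1) /\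
  lexp (Some c) (tofrac P)^-1 0 = P.[c]^-1.
Proof.
move=> /Ppol_horner_neq0 h; rewrite lexpV lexp_poly; have [h0 h1] := lpoly_some c P.
rewrite -[X in lorder_ge X]oppr0 -[X in lcoef _ X]oppr0 -h1; apply: lorderV => //.
by rewrite h1.
Qed.

(** One formula for all i: at infinity u is the expansion of x^(n-2), coming from the change of
    trivialization, and e is that of its logarithmic derivative; at finite points they are 1 and
    0. *)
Lemma conn_at_mx2 i (a c d : {fraction {poly C}}) :
  conn_at m t i (mx2 0 a c d) =
  let l := lderiv (lx (pt t i)) in
  let u := if i is Some _ then 1 else lexp None (tofrac 'X^(ntot m - 2)) in
  let e := if i is Some _ then 0 else
    lexp None (tofrac ('X^(ntot m - 2))^`()) / u in
  mx2 0 (lexp (pt t i) a * u * l) (lexp (pt t i) c / u * l) ((lexp (pt t i) d + e) * l).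
Proof.
case: i => [i|]; rewrite /conn_at /lform /= ?lderiv_lx_some ?rgauge_Gmx.
  by apply: eq_mx2; rewrite mxE !mx2E ?rmorph0 ?mul0r ?invr1 ?mulr1 ?addr0.
by apply: eq_mx2; rewrite mxE !mx2E ?rmorph0 ?mul0r// ?lexpD ?lexpM ?lexpV.
Qed.

(** This entry comes from 1/P, which all normal forms share; its exact order -n_i is what allows
    [gauge_polar_part] to divide by it. *)
Lemma conn_at01 i : exists2 f : laurent C, lorder_ge (- (m i)%:Z) f /\ f (- (m i)%:Z) != 0 &
  forall c d, conn_at m t i (mx2 0 (tofrac P)^-1 c d) 0 1 = f.
Proof.
eexists; last by move=> c d; rewrite conn_at_mx2 /= mx2E.
case: i => [i|] /=.
  rewrite lderiv_lx_some !mulr1 lexpV lexp_poly.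
  have [q eP qt] := Ppol_factor i; have [h0 h1] := lpoly_some_order eP.
  by have [|hV V1] := lorderV h0; rewrite ?V1 ?h1 ?invr_eq0.
rewrite lderiv_lx_none lexpV !lexp_poly rmorphXn /= lpolyX /= exprVn lXnV.
have [h0 h1] := lpoly_none P.
have [|hV V1] := lorderV h0; first by rewrite h1 lead_coef_eq0 Ppol_neq0.
rewrite opprK in hV V1; rewrite mulrN -mulrA lmono1M mulrC.
(* Orders at infinity: x^(n-2) gives -(n-2), dx gives -2, and 1/P gives n - n_infty, the degree of
   P; the sum is - n_infty. *)
have mE : - (m None)%:Z = - (ntot m - 2)%N%:Z + -2 + (size P).-1%:Z.
  by rewrite size_Ppol; have := ntot_ge3; rewrite ntotE; lia.
rewrite mE; split; last first.
  rewrite lcoefN lcoef_monoM mul1r addrC addKr V1 oppr_eq0 invr_eq0.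
  by rewrite h1 lead_coef_eq0 Ppol_neq0.
by apply: lorder_geN; apply: lorder_geM hV; apply: lorder_ge_mono.
Qed.

(** Two normal forms have the same formal type at t_i, the same entry (0, 1) and a zero entry (0,
    0), so [gauge_polar_part] applies. *)
Lemma conn_at_polar i (y y' : Pt C m) Om Om' :
  normal_form t th y Om -> normal_form t th y' Om' ->
  mx_hol (conn_at m t i Om - conn_at m t i Om').
Proof.
move=> [[Cf [Df [Ct [Ci [Di [_ _ _ _ eO]]]]]] _ /(_ i)[X uX gX]].
move=> [[Cf' [Df' [Ct' [Ci' [Di' [_ _ _ _ eO']]]]]] _ /(_ i)[X' uX' gX']].
have [f [h0 h1] hf] := conn_at01 i.
have A01 : conn_at m t i Om 0 1 = f by rewrite eO; apply: hf.
have A'01 : conn_at m t i Om' 0 1 = f by rewrite eO'; apply: hf.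
have A00 : conn_at m t i Om 0 0 = 0 by rewrite eO conn_at_mx2 mx2E.
have A'00 : conn_at m t i Om' 0 0 = 0 by rewrite eO' conn_at_mx2 mx2E.
rewrite -A01 in h0 h1 A'01.
apply: (gauge_polar_part uX uX' gX gX' _ A00 A'00 A'01 h0 h1) => a b.
rewrite diag2E; case: eqP => _; last by rewrite mulr0n.
rewrite mulr1n; apply: lorder_ge_sum => l _; rewrite lXn lXnV.
rewrite -mulrA lmono1M; apply: (@lorder_geW _ (0 + (l%:Z - (m i)%:Z))); first by lia.
by apply: lorder_geM; [apply: lorder_ge_cst|apply: lorder_ge_mono].
Qed.

End Setting.

(** * Entries of the normal form and their dependence on the point *)

Section NormalForm.
Variables (C : numClosedFieldType) (nu : nat).
Variables (m : option 'I_nu -> nat) (t : 'I_nu -> C).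
Variable th : option 'I_nu -> 'I_2 -> nat -> C.
Hypotheses (hnu : (2 <= nu)%N) (hm : forall i, (1 <= m i)%N) (tI : injective t).
Local Notation P := (Ppol m t).
Implicit Types (y : Pt C m) (Om : 'M[{fraction {poly C}}]_2).

Lemma conn_at11 y Om i : normal_shape t y Om ->
  conn_at m t i Om 1 1 = (lexp (pt t i) (Om 1 1) +
    if i is Some _ then 0 else
      lexp None (tofrac ('X^(ntot m - 2))^`()) / lexp None (tofrac 'X^(ntot m - 2)))
    * lderiv (lx (pt t i)).
Proof. by move=> [Cf [Df [Ct [Ci [Di [_ _ _ _ ->]]]]]]; rewrite conn_at_mx2 /= !mx2E; case: i. Qed.

(** The part of - d_0 with poles at the q_j; by [normal_form_numerator] it is the only part of d_0
    that varies with the point. *)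
Definition simple_poles y : {fraction {poly C}} :=
  \sum_j (tofrac ('X - (qc y j)%:P))^-1.

Lemma simple_poles_some y c : (forall j, qc y j != c) ->
  lorder_ge 0 (lexp (Some c) (simple_poles y)).
Proof.
move=> h; rewrite lexp_sum; apply: lorder_ge_sum => j _.
by apply: (lexp_XsubC_V_some _).1; rewrite eq_sym.
Qed.

Lemma simple_poles_none y : lorder_ge 1 (lexp None (simple_poles y)).
Proof. by rewrite lexp_sum; apply: lorder_ge_sum => j _; apply: lexp_XsubC_V_none. Qed.

Lemma partial_fractions (Df : 'I_nu -> {poly C}) (Dinf : {poly C}) :
  exists N : {poly C},
    \sum_i tofrac (Df i) / tofrac (('X - (t i)%:P) ^+ m (Some i)) + tofrac Dinf =
    tofrac N / tofrac P.
Proof.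
exists (\sum_i Df i * \prod_(k | k != i) ('X - (t k)%:P) ^+ m (Some k) + Dinf * P).
have P0 : tofrac P != 0 by rewrite tofrac_eq0 Ppol_neq0.
apply: (mulIf P0); rewrite mulfVK// mulrDl tofracD tofracM; congr (_ + _).
rewrite mulr_suml rmorph_sum /=; apply: eq_bigr => i _.
set a := _ ^+ _; set b := \prod_(k | _) _.
have eP : P = a * b by rewrite /Ppol (bigD1 i).
rewrite eP !tofracM mulrA; congr (_ * _); apply: mulfVK.
by rewrite tofrac_eq0 expf_neq0 ?polyXsubC_eq0.
Qed.

(** All summands of c_0 other than p_j / (x - q_j) are regular at q_j, so only its residue p_j is
    recorded. *)
Lemma normal_shape_entries y Om : normal_shape t y Om -> Mt t y ->
  exists N c, [/\ Om = mx2 0 (tofrac P)^-1 c (tofrac N / tofrac P - simple_poles y) &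
    forall j, lorder_ge (-1) (lexp (Some (qc y j)) c) /\
              lexp (Some (qc y j)) c (-1) = pc y j].
Proof.
move=> [Cf [Df [Ct [Ci [Di [_ _ _ _ ->]]]]]] [qI qt].
have [N eN] := partial_fractions Df Di; have [M eM] := partial_fractions Cf Ct.
exists N, (c0 t y Cf Ct Ci); split; first by rewrite /d0 addrAC eN.
move=> j; rewrite /c0 [X in X + tofrac (_ * _)]addrAC eM; set q := qc y j.
have qP : forall i, q != t i by move=> i; apply: qt.
set r := (X in lexp _ X).
have -> : r = (tofrac M / tofrac P + tofrac ('X^(nq m) * Ci)
    + \sum_(k | k != j) tofrac (pc y k)%:P / tofrac ('X - (qc y k)%:P))
    + tofrac (pc y j)%:P / tofrac ('X - q%:P).
  by rewrite /r (bigD1 j)//= [LHS]addrAC [X in _ + X = _]addrC addrA.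
rewrite lexpD /=; set h := lexp _ _.
have hh : lorder_ge 0 h.
  rewrite /h lexpD lexpD lexp_sum /=; apply: lorder_geD; first apply: lorder_geD.
  - rewrite lexpM lexp_poly -[X in lorder_ge X]addr0; apply: lorder_geM.
      exact: (lpoly_some _ _).1.
    exact: (lexp_PpolV_some _ qP).1.
  - by rewrite lexp_poly; apply: (lpoly_some _ _).1.
  apply: lorder_ge_sum => k kj; rewrite lexpM lexp_poly lpolyC.
  rewrite -[X in lorder_ge X]addr0; apply: lorder_geM; first exact: lorder_ge_cst.
  by apply: (lexp_XsubC_V_some _).1; rewrite (inj_eq qI) eq_sym.
rewrite lexpM /= lexp_poly lpolyC lexp_XsubC_V; split.
  apply: lorder_geD; first exact: lorder_geW hh.
  rewrite -[X in lorder_ge X]add0r; apply: lorder_geM; first exact: lorder_ge_cst.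
  exact: lorder_ge_mono.
by rewrite lcoefD (lorder_geE hh)// add0r lcoef_cstM lcoef_mono eqxx mulr1.
Qed.

(** The quotient (N - N') / P is regular at every t_i, where the polar parts agree, hence a
    polynomial; it vanishes at infinity, hence is 0. *)
Lemma normal_form_numerator y y' Om Om' N N' : Mt t y -> Mt t y' ->
  normal_form t th y Om -> normal_form t th y' Om' ->
  Om 1 1 = tofrac N / tofrac P - simple_poles y ->
  Om' 1 1 = tofrac N' / tofrac P - simple_poles y' -> N = N'.
Proof.
move=> My My' nO nO' eN eN'.
have hD i : lorder_ge 0 (lexp (pt t i) (Om 1 1 - Om' 1 1) * lderiv (lx (pt t i))).
  have [sO _ _] := nO; have [sO' _ _] := nO'.
  have h := mx_hol_subE 1 1 (conn_at_polar hnu hm tI i nO nO').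
  have e := f_equal2 (fun f g => f - g) (conn_at11 i sO) (conn_at11 i sO').
  (* The logarithmic derivative of x^(n-2), present at infinity, cancels in the difference. *)
  rewrite e -mulrBl opprD addrACA subrr addr0 in h.
  by rewrite lexpB.
have eD : tofrac (N - N') / tofrac P = (Om 1 1 - Om' 1 1) + (simple_poles y - simple_poles y').
  by rewrite eN eN' tofracB mulrBl; ring.
have PN : P %| N - N'.
  apply: (Ppol_dvd tI) => i; have [q eP qt] := Ppol_factor m tI i.
  apply: lexp_dvdp eP qt _; rewrite eD lexpD lexpB.
  apply: lorder_geD; first by have := hD (Some i); rewrite /= lderiv_lx_some mulr1 lexpB.
  by rewrite lexpB; apply: lorder_geB; apply: simple_poles_some => j; [apply: My.2|apply: My'.2].
have h1 : lorder_ge 1 (lexp None (tofrac (N - N') / tofrac P)).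
  rewrite eD lexpD; apply: lorder_geD; last first.
    by rewrite lexpB; apply: lorder_geB; apply: simple_poles_none.
  have := hD None; rewrite /= lderiv_lx_none => h.
  set f := lexp _ _ in h *.
  (* Since dx = - w^-2 dw, a form regular at infinity has a coefficient function vanishing there to
     order at least 2. *)
  have -> : f = (f * - lmono (-2) 1) * (- lmono 2 1).
    by rewrite -mulrA mulrNN lmono1M mulr1.
  apply: (@lorder_geW _ (0 + 2)) => //; apply: lorder_geM => //.
  by apply: lorder_geN; apply: lorder_ge_mono.
apply/eqP; rewrite -subr_eq0; apply/eqP; move: PN => /dvdpP[Q eQ].
have P0 := Ppol_neq0 m t.
move: h1; rewrite eQ tofracM mulfK ?tofrac_eq0// lexp_poly => h1.
have [_ h2] := lpoly_none Q; have [->|Q0] := eqVneq Q 0; first by rewrite mul0r.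
move: h2; rewrite h1; last by lia.
by move/esym/eqP; rewrite lead_coef_eq0 (negPf Q0).
Qed.

End NormalForm.

(** * Derivatives along a vector of functions and of Laurent coefficients *)

Section Derivatives.
Variables (C : numClosedFieldType) (V : normedModType C).
Implicit Types (y v : V) (f g q : V -> C).

Lemma is_derive_horner (p : {poly C}) q y v (dq : C) : is_derive y v q dq ->
  is_derive y v (fun z => p.[q z]) (p^`().[q y] * dq).
Proof.
move=> hq; elim/poly_ind: p => [|p c hp].
  rewrite deriv0 horner0 mul0r; have -> : (fun z => (0 : {poly C}).[q z]) = cst 0.
    by apply/funext => z; rewrite horner0.
  exact: is_derive_cst.
have -> : (fun z => (p * 'X + c%:P).[q z]) = (fun z => p.[q z]) * q + cst c.
  by apply/funext => z; rewrite hornerMXaddC.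
apply: is_derive_eq; rewrite addr0 derivMXaddC hornerD hornerMX /GRing.scale /=; ring.
Qed.

Lemma is_deriveMf f g y v (df dg : C) : is_derive y v f df -> is_derive y v g dg ->
  is_derive y v (fun z => f z * g z) (f y * dg + df * g y).
Proof. by move=> hf hg; apply: is_derive_eq; rewrite [df * _]mulrC. Qed.

Lemma is_deriveVf f y v (df : C) : f y != 0 -> is_derive y v f df ->
  is_derive y v (fun z => (f z)^-1) (- (f y) ^- 2 * df).
Proof.
move=> fy [hf <-]; apply: DeriveDef; first exact: derivableV.
by rewrite deriveV.
Qed.

Lemma is_derive_frac (n d : {poly C}) q y v (dq : C) : d.[q y] != 0 ->
  is_derive y v q dq ->
  is_derive y v (fun z => n.[q z] / d.[q z])
    ((n.[q y] * (- d.[q y] ^- 2 * d^`().[q y]) + n^`().[q y] / d.[q y]) * dq).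
Proof.
move=> d0 hq.
have [h1 h2] := is_deriveMf (is_derive_horner n hq) (is_deriveVf d0 (is_derive_horner d hq)).
by apply: DeriveDef => //; rewrite h2; ring.
Qed.

(** The coefficients below a are constant near y, so their derivatives vanish and the family of
    derivatives has bounded poles; the default value of [insubd] is thus not taken. *)
Lemma ldelta_near (a : int) v (L : V -> laurent C) y :
  (\forall z \near y, lorder_ge a (L z - L y)) ->
  (forall k, ldelta v L y k = 'D_v (fun z => L z k : C) y) /\ lorder_ge a (ldelta v L y).
Proof.
move=> h; have d0 k : k < a -> 'D_v (fun z => L z k : C) y = 0.
  move=> ka; rewrite (@near_eq_derive _ _ _ _ (cst (L y k)) _ v) ?derive_cst//.
  by apply: filterS h => z /(_ k ka) e; apply/eqP; rewrite -subr_eq0 -[_ - _]lcoefB e.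
have hb : `[< exists N, 
      @Defs.lbound C (fun k : int => 'D_v (fun z => L z k : C) y : C) N >].
  by apply/asboolP; exists `|a|%N => k ka; apply: d0; lia.
have e k : ldelta v L y k = 'D_v (fun z => L z k : C) y.
  by rewrite /ldelta /insubd insubT.
by split=> // k /d0 <-.
Qed.

End Derivatives.

(** * The coordinates q_j, p_j and the open set of admissible points *)

Section Points.
Local Open Scope classical_set_scope.
Variables (C : numClosedFieldType) (nu : nat) (m : option 'I_nu -> nat) (t : 'I_nu -> C).
Implicit Types y v : Pt C m.

Lemma differentiable_qc j y : differentiable (fun z : Pt C m => qc z j : C) y.
Proof.
have h : differentiable (fst : Pt C m -> _) y.
  by apply: linear_differentiable => x; apply: cvg_fst.
exact: (differentiable_comp h (differentiable_coord _ _ _)).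
Qed.

Lemma differentiable_pc j y : differentiable (fun z : Pt C m => pc z j : C) y.
Proof.
have h : differentiable (snd : Pt C m -> _) y.
  by apply: linear_differentiable => x; apply: cvg_snd.
exact: (differentiable_comp h (differentiable_coord _ _ _)).
Qed.

(** The set is cut out by finitely many conditions of the form f != 0 with f continuous. Its
    openness lets identities valid only on [Mt] be differentiated. *)
Lemma near_Mt y : Mt t y -> \forall z \near y, Mt t z.
Proof.
move=> [qI qt].
have qc_cont j : (fun z : Pt C m => qc z j : C) @ y --> qc y j.
  exact/differentiable_continuous/differentiable_qc.
have near_neq j x : qc y j != x -> \forall z \near y, qc z j != x.
  rewrite -subr_eq0 => h.
  have := cvgr_neq0 _ (cvgB (qc_cont j) (cvg_cst x)) h.
  move=> hh; near=> z; rewrite -subr_eq0; near: z; exact: hh.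
have h1 : \forall z \near y, forall j i, qc z j != t i.
  pose G (ji : 'I_(nq m) * 'I_nu) := [set z : Pt C m | qc z ji.1 != t ji.2].
    have /filter_forall : forall ji, \forall z \near y, G ji z by move=> ji; apply: near_neq.
    by apply: filterS => z h j i; exact: (h (j, i)).
have h2 : \forall z \near y, forall j k, j != k -> qc z j != qc z k.
  pose G (jk : 'I_(nq m) * 'I_(nq m)) := [set z : Pt C m | jk.1 != jk.2 -> qc z jk.1 != qc z jk.2].
  suff /filter_forall : forall jk, \forall z \near y, G jk z.
    by apply: filterS => z h j k; exact: (h (j, k)).
  move=> [j k]; rewrite /G /=.
  have [->|jk] := eqVneq j k; first by near=> z.
  have jk0 : qc y j - qc y k != 0 by rewrite subr_eq0 (inj_eq qI).
  have := cvgr_neq0 _ (cvgB (qc_cont j) (qc_cont k)) jk0.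
  by move=> hh; near=> z => _; rewrite -subr_eq0; near: z; exact: hh.
near=> z; split; last by near: z.
move=> j k e; apply/eqP/negPn/negP => jk.
have : qc z j != qc z k by move: j k jk {e}; near: z.
by rewrite e eqxx.
Unshelve. all: by end_near. Qed.

End Points.

(** * The residue pairing near an apparent singularity *)

Section ResidueAlgebra.
Variable C : numClosedFieldType.
Implicit Types (W M S : 'M[laurent C]_2) (c p : C).

(** A symmetric pairing, bilinear over the constants; [res_wedge] is obtained from it by
    antisymmetrization. *)
Definition rtr W M : C := lres (\tr (W *m M)).

Lemma rtrE W M : rtr W M =
  (W 0 0 * M 0 0) (-1) + (W 0 1 * M 1 0) (-1) + ((W 1 0 * M 0 1) (-1) + (W 1 1 * M 1 1) (-1)).
Proof. by rewrite /rtr mxtrace2E !mulmx2E. Qed.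

Lemma rtr_hol W M : mx_hol W -> mx_hol M -> rtr W M = 0.
Proof.
move=> hW hM; rewrite rtrE.
have h i j k l : (W i j * M k l) (-1) = 0.
  by apply: (lorder_geE (a := 0 + 0)) => //; apply: lorder_geM.
by rewrite !h !addr0.
Qed.

Lemma rtrC W M : rtr W M = rtr M W.
Proof. by rewrite /rtr mxtrace_mulC. Qed.

Lemma rtrDl W1 W2 M : rtr (W1 + W2) M = rtr W1 M + rtr W2 M.
Proof. by rewrite /rtr mulmxDl mxtraceD. Qed.

Lemma rtrNl W M : rtr (- W) M = - rtr W M.
Proof. by rewrite /rtr mulNmx raddfN. Qed.

Lemma rtrZl c W M : rtr (lcst c *: W) M = c * rtr W M.
Proof. by rewrite /rtr -scalemxAl mxtraceZ; exact: lcoef_cstM. Qed.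

Lemma rtrDr W M1 M2 : rtr W (M1 + M2) = rtr W M1 + rtr W M2.
Proof. by rewrite !(rtrC W) rtrDl. Qed.

Lemma rtrZr c W M : rtr W (lcst c *: M) = c * rtr W M.
Proof. by rewrite !(rtrC W) rtrZl. Qed.

Lemma res_wedge_rtr A1 B1 A2 B2 : res_wedge A1 B1 A2 B2 = rtr A1 B2 - rtr A2 B1.
Proof. by rewrite (rtrC A2) /rtr /res_wedge raddfB. Qed.

Lemma res_wedge_hol A1 B1 A2 B2 : mx_hol A1 -> mx_hol B1 -> mx_hol A2 -> mx_hol B2 ->
  res_wedge A1 B1 A2 B2 = 0 :> C.
Proof. by move=> h1 h2 h3 h4; rewrite res_wedge_rtr !rtr_hol ?subr0. Qed.

(** In the application W is the connection matrix, W' its derivative in u, and W1, W2, M1, M2 come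
    from derivatives at fixed u. The terms c1 c2 res Tr(W' W) cancel by antisymmetry. *)
Lemma res_wedge_expand W W' W1 W2 M1 M2 c1 c2 :
  res_wedge (W1 - lcst c1 *: W') (M1 + lcst c1 *: W)
            (W2 - lcst c2 *: W') (M2 + lcst c2 *: W) =
  rtr W1 M2 - rtr W2 M1 + c2 * rtr W1 W - c1 * rtr W2 W
  - c1 * rtr W' M2 + c2 * rtr W' M1.
Proof.
rewrite res_wedge_rtr !rtrDl !rtrDr !rtrNl !rtrZl !rtrZr [rtr W' W]rtrC; ring.
Qed.

(* At q_j, with X_s = [[1, 0], [p, 1]] Xi_s and D the derivative of X at fixed u,
   M = D X^-1; x and y are the entries (0, 1) and (1, 1) of Xi_1. *)
Lemma log_delta_coef (X D : nat -> 'M[C]_2) M p x y dp dx dy :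
  mx_hol M -> M *m lser_mx X = lser_mx D ->
  X 0%N = mx2 1 0 p 1 -> D 0%N = mx2 0 0 dp 0 ->
  X 1%N 0 1 = x -> X 1%N 1 1 = p * x + y ->
  D 1%N 0 1 = dx -> D 1%N 1 1 = p * dx + dp * x + dy ->
  M 0 1 0 = 0 /\ M 1 1 1 = p * M 0 1 1 + dy.
Proof.
move=> hM e X0 D0 x0 x1 d0 d1.
have hS i j : lorder_ge 0 (lser_mx X i j) by exact: mx_hol_ser.
have cS i j n : lser_mx X i j (Posz n) = X n i j by rewrite mxE.
have cD i j n : lser_mx D i j (Posz n) = D n i j by rewrite mxE.
have e0 i j : M i 0 0 * X 0%N 0 j + M i 1 0 * X 0%N 1 j = D 0%N i j.
  have := congr1 (fun B : 'M[laurent C]_2 => B i j (0 + 0)) e; rewrite /= mulmx2E lcoefD.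
  by rewrite !lcoefM0// !cS cD.
have e1 i j : M i 0 0 * X 1%N 0 j + M i 0 1 * X 0%N 0 j
    + (M i 1 0 * X 1%N 1 j + M i 1 1 * X 0%N 1 j) = D 1%N i j.
  have := congr1 (fun B : 'M[laurent C]_2 => B i j (0 + 0 + 1)) e; rewrite /= mulmx2E lcoefD.
  by rewrite !lcoefM1// !cS cD.
move: (e0 0 0) (e0 0 1) (e0 1 0) (e0 1 1) (e1 0 1) (e1 1 1).
rewrite X0 D0 !mx2E x0 x1 d0 d1 !mulr0 !mulr1 !add0r => + m01 + m11.
rewrite m01 m11 !mul0r !addr0 => m00 m10; rewrite m00 m10 !mul0r !add0r => -> e11.
by split=> //; apply: (addrI (dp * x)); rewrite e11; ring.
Qed.

(** The only possible residue is that of W_10 M_01, where a simple pole meets a zero of M_01. *)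
Lemma rtr_mdelta_log W M : lorder_ge 0 (W 0 0) -> lorder_ge 0 (W 0 1) ->
  lorder_ge (-1) (W 1 0) -> lorder_ge 0 (W 1 1) -> mx_hol M -> M 0 1 0 = 0 ->
  rtr W M = 0.
Proof.
move=> h00 h01 h10 h11 hM m01; rewrite rtrE.
have h (f g : laurent C) : lorder_ge 0 f -> lorder_ge 0 g -> (f * g) (-1) = 0.
  by move=> hf hg; apply: (lorder_geE (a := 0 + 0)) => //; apply: lorder_geM.
rewrite (h (W 0 0))// (h (W 0 1))// (h (W 1 1))// !addr0 add0r.
by have := lcoefM0 h10 (hM 0 1); rewrite addr0 m01 mulr0.
Qed.

(** Each product has order at least -1 and contributes the product of its lowest coefficients. In
    the application W is the derivative of W0 at fixed u, and W_11 is regular because the residue -1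
    of W0_11 is constant. *)
Lemma rtr_mdelta_conn W W0 p : lorder_ge 0 (W 0 1) ->
  lorder_ge (-1) (W 1 0) -> lorder_ge 0 (W 1 1) ->
  W0 0 0 = 0 -> lorder_ge 0 (W0 0 1) ->
  lorder_ge (-1) (W0 1 0) -> W0 1 0 (-1) = p ->
  lorder_ge (-1) (W0 1 1) -> W0 1 1 (-1) = -1 ->
  rtr W W0 = W 0 1 0 * p + W 1 0 (-1) * W0 0 1 0 - W 1 1 0.
Proof.
move=> h01 h10 h11 w00 g01 g10 e10 g11 e11; rewrite rtrE w00 mulr0 lcoef0 add0r.
have := lcoefM0 h01 g10; have := lcoefM0 h10 g01; have := lcoefM0 h11 g11.
by rewrite addr0 add0r e10 e11 mulrN1 => -> -> ->; rewrite addrA.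
Qed.

(** The double poles of W' pick out coefficients of u in M; a derivative has no residue, so the
    constant terms of M do not enter. *)
Lemma rtr_deriv_log W M p : W 0 0 = 0 -> lorder_ge 0 (W 0 1) ->
  lorder_ge (-1) (W 1 0) -> W 1 0 (-1) = p ->
  lorder_ge (-1) (W 1 1) -> W 1 1 (-1) = -1 -> mx_hol M ->
  rtr (map_mx (@lderiv C) W) M = - p * M 0 1 1 + M 1 1 1.
Proof.
move=> w00 h01 h10 e10 h11 e11 hM.
have mE i j : map_mx (@lderiv C) W i j = lderiv (W i j) by rewrite mxE.
rewrite rtrE !mE w00; have -> : lderiv 0 = 0 :> laurent C.
  by apply: laurent_eq => k; rewrite lderivE lcoef0 mul0rz.
have hd f : lorder_ge (-1) f -> lorder_ge (- 2) (lderiv f).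
  by move=> /lorder_ge_deriv; apply: lorder_geW.
have h (f g : laurent C) : lorder_ge (-1) f -> lorder_ge 0 g ->
    (lderiv f * g) (-1) = - f (-1) * g 1.
  move=> hf hg; have := lcoefM1 (hd _ _ hf) hg.
  have -> : -2 + 0 + 1 = -1 :> int by [].
  move=> ->; rewrite !lderivE add0r.
  have -> : -2 + 1 = -1 :> int by [].
  have -> : -1 + 1 = 0 :> int by [].
  by rewrite mulr0z mul0r addr0; congr (_ * _); rewrite NegzE mulrN1z.
rewrite (h _ _ h10 (hM 0 1)) (h _ _ h11 (hM 1 1)) e10 e11 opprK mul1r mul0r lcoef0.
have h01' := lorder_geM (lorder_ge_deriv0 h01) (hM 1 0).
by rewrite (lorder_geE h01')// !add0r.
Qed.

(* Compares the coefficients of u in the second column of psi' + W psi = 0. *)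
Lemma solution_coef (X : nat -> 'M[C]_2) W p x y :
  map_mx (@lderiv C) (lser_mx X *m mx2 1 0 0 lX) + W *m (lser_mx X *m mx2 1 0 0 lX) = 0 ->
  W 0 0 = 0 -> lorder_ge 0 (W 0 1) -> lorder_ge (-1) (W 1 0) -> W 1 0 (-1) = p ->
  lorder_ge (-1) (W 1 1) -> W 1 1 (-1) = -1 ->
  X 0%N = mx2 1 0 p 1 -> X 1%N 0 1 = x -> X 1%N 1 1 = p * x + y ->
  y = p * W 0 1 0 - W 1 1 0.
Proof.
move=> e w00 h01 h10 e10 h11 e11 X0 x0 x1.
set psi := _ *m mx2 _ _ _ _ in e.
have psi1 i : psi i 1 = lser_mx X i 1 * lX.
  by rewrite mulmx2E !mx2E mulr0 add0r.
have cpsi i (n : nat) : psi i 1 (n%:Z + 1) = X n i 1.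
  have cX : lser_mx X i 1 n = X n i 1 by rewrite mxE.
  by rewrite psi1 mulrC lcoef_XM addrK.
have hpsi i : lorder_ge 1 (psi i 1).
  rewrite psi1 -[X in lorder_ge X]add0r; apply: lorder_geM; last exact: lorder_ge_mono.
  exact: mx_hol_ser.
have p01 : psi 0 1 1 = 0 by have := cpsi 0 0%N; rewrite add0r X0 mx2E.
have p11 : psi 1 1 1 = 1 by have := cpsi 1 0%N; rewrite add0r X0 mx2E.
have p02 : psi 0 1 (1 + 1) = x by rewrite (cpsi 0 1%N).
have p12 : psi 1 1 (1 + 1) = p * x + y by rewrite (cpsi 1 1%N).
have E i : lderiv (psi i 1) 1 + ((W i 0 * psi 0 1) 1 + (W i 1 * psi 1 1) 1) = 0.
  have mD (A B : 'M[laurent C]_2) : (A + B) i 1 = A i 1 + B i 1 by rewrite mxE.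
  have m0 : (0 : 'M[laurent C]_2) i 1 = 0 by rewrite mxE.
  have md : map_mx (@lderiv C) psi i 1 = lderiv (psi i 1) by rewrite mxE.
  have := congr1 (fun B : 'M[laurent C]_2 => B i 1 1) e.
  by rewrite /= mD mulmx2E md m0 !lcoefD.
have := E 0; have := E 1; rewrite w00 mul0r lcoef0 add0r !lderivE p02 p12.
have -> : (W 0 1 * psi 1 1) 1 = W 0 1 0.
  by rewrite -[X in lcoef _ X]add0r lcoefM0// p11 mulr1.
have c1 (f g : laurent C) : lorder_ge (-1) f -> lorder_ge 1 g ->
    (f * g) 1 = f (-1) * g (1 + 1) + f 0 * g 1.
  by move=> hf hg; have := lcoefM1 hf hg; rewrite addNr add0r.
rewrite !c1// e10 e11 p01 p11 p02 p12 mulr0 addr0 mulr1.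
(* The top row reads 2x + W_01(0) = 0; substituting it into the bottom row eliminates x. *)
move=> e1 e0; have -> : W 0 1 0 = - (x + x).
  by apply/eqP; rewrite -addr_eq0 addrC -e0.
apply/eqP; rewrite -subr_eq0 -e1 -!pmulrn; apply/eqP; ring.
Qed.

End ResidueAlgebra.

(** * Families of power series, differentiated coefficient by coefficient *)

Lemma lmx_cst_ser (C : numClosedFieldType) (A : 'M[C]_2) (X : nat -> 'M[C]_2) :
  lmx_cst A *m lser_mx X = lser_mx (fun s => A *m X s).
Proof.
apply/matrixP => i j; rewrite mulmx2E; apply: laurent_eq => k.
have cE (c : C) (f : nat -> C) : lcst c * lseries f = lseries (fun s => c * f s).
  by apply: laurent_eq => -[n|n]; rewrite lcoef_cstM//; apply: mulr0.
by rewrite !mxE !cE lcoefD; case: k => [n|n]; rewrite /lcoef /= ?addr0 ?mulmx2E.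
Qed.

Lemma mdelta_ser (C : numClosedFieldType) (V : normedModType C) (v y : V)
    (X : V -> nat -> 'M[C]_2) :
  mdelta v (fun z => lser_mx (X z)) y =
  lser_mx (fun s => \matrix_(i, j) 'D_v (fun z => X z s i j : C) y).
Proof.
apply/matrixP => i j; rewrite mxE; apply: laurent_eq => k.
have h : \forall z \near y, lorder_ge 0 (lser_mx (X z) i j - lser_mx (X y) i j).
  by near=> z; apply: lorder_geB; apply: mx_hol_ser.
have [e o] := ldelta_near v h; rewrite [lser_mx _ i j in RHS]mxE.
case: k => [n|n]; last by rewrite o.
by rewrite e lcoef_series mxE; congr ('D_v _ y); apply/funext => z; rewrite mxE.
Unshelve. all: by end_near. Qed.

(** * Holomorphy at the t_i and expansions at the q_j *)

Section Main.
Variables (C : numClosedFieldType) (nu : nat).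
Variables (m : option 'I_nu -> nat) (t : 'I_nu -> C).
Variable th : option 'I_nu -> 'I_2 -> nat -> C.
Local Notation P := (Ppol m t).
Variable Om : Pt C m -> 'M[{fraction {poly C}}]_2.
Implicit Types (y v : Pt C m).

(** The polar part of Lambda_i involves only prescribed exponents, so it does not vary; Phi Xi has
    the invertible constant term Phi, so its inverse is holomorphic. *)
Lemma fe_delta_log_hol i (Phi : 'M[C]_2) (Xi : Pt C m -> nat -> 'M[C]_2)
    (TH : Pt C m -> 'I_2 -> nat -> C) v y :
  Phi \in unitmx ->
  (forall z, Mt t z -> formal_solution m t th i Phi (Om z) (Xi z) (TH z)) ->
  Mt t y -> mx_hol (fe_delta_log v (fun z => psi_t m i Phi (Xi z) (TH z)) y).
Proof.
move=> uPhi hs My; rewrite /fe_delta_log /psi_t /=.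
have -> : (fun z => lmx_cst Phi *m lser_mx (Xi z)) =
    (fun z => lser_mx (fun s => Phi *m Xi z s)).
  by apply/funext => z; rewrite lmx_cst_ser.
rewrite lmx_cst_ser mdelta_ser; apply: mx_holM; last first.
  by apply: (mx_hol_inv _).2; have [-> _ _ _] := hs y My; rewrite mulmx1.
apply: mx_holB; first exact: mx_hol_ser.
apply: mx_holM; first exact: mx_hol_ser.
move=> a b; rewrite diag2E; case: eqP => _; last by rewrite mulr0n.
rewrite mulr1n; apply: (ldelta_near v _).2.
apply: filterS (near_Mt My) => z Mz k k0.
rewrite lcoefB; apply/eqP; rewrite subr_eq0; apply/eqP.
change (lprim_fun (lseries (TH z a) / lX ^+ m i) k = lprim_fun (lseries (TH y a) / lX ^+ m i) k).
rewrite /lprim_fun; case: ifP => // _; congr (_ / _).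
rewrite lXnV ![_ * lmono _ _]mulrC !lcoef_monoM; congr (_ * _).
case E: (k - 1 - - (m i)%:Z) => [n|n] //.
(* For k < 0 the coefficient of u^k in the primitive comes from the exponent of index k - 1 + n_i <
   n_i, whose value is prescribed. *)
have ni : (n < m i)%N by lia.
have [_ _ hz _] := hs z Mz; have [_ _ hy _] := hs y My.
by rewrite !lcoef_series hz// hy.
Qed.

(* The summand k = j is 0^-1 = 0. *)
Definition regular_part (N : {poly C}) j y : C :=
  N.[qc y j] / P.[qc y j] - \sum_k (qc y j - qc y k)^-1.

(** The summand k = j of [simple_poles] carries the whole pole of the entry (1, 1); the other
    summands and N / P are regular at q_j and give its constant term. *)
Lemma conn_at_q (N : {poly C}) c y j : Mt t y ->
  Om y = mx2 0 (tofrac P)^-1 c (tofrac N / tofrac P - simple_poles y) ->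
  lorder_ge (-1) (lexp (Some (qc y j)) c) -> lexp (Some (qc y j)) c (-1) = pc y j ->
  let W := lform (Some (qc y j)) (Om y) in
  [/\ W 0 0 = 0, lorder_ge 0 (W 0 1) /\ W 0 1 0 = P.[qc y j]^-1,
      lorder_ge (-1) (W 1 0) /\ W 1 0 (-1) = pc y j,
      lorder_ge (-1) (W 1 1) /\ W 1 1 (-1) = -1 & W 1 1 0 = regular_part N j y].
Proof.
move=> [qI qt] e hc ec W; set q := qc y j in hc ec W *.
have WE a b : W a b = lexp (Some q) (Om y a b) by rewrite mxE lderiv_lx_some mulr1.
have [p0 p1] := lexp_PpolV_some m (qt j).
rewrite !WE e !mx2E rmorph0 lexpB lexpM lexp_poly -/q.
have [n0 n1] := lpoly_some q N.
have h0 : lorder_ge 0 (lpoly (Some q) N * lexp (Some q) (tofrac P)^-1).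
  by rewrite -[X in lorder_ge X]addr0; apply: lorder_geM.
have h1 : (lpoly (Some q) N * lexp (Some q) (tofrac P)^-1) 0 = N.[q] / P.[q].
  by have := lcoefM0 n0 p0; rewrite addr0 n1 p1.
rewrite /simple_poles lexp_sum (bigD1 j)//= lexp_XsubC_V.
set s := \sum_(k | _) _.
have s0 : lorder_ge 0 s.
  by apply: lorder_ge_sum => k kj; apply: (lexp_XsubC_V_some _).1; rewrite (inj_eq qI) eq_sym.
have s1 : s 0 = \sum_(k | k != j) (q - qc y k)^-1.
  rewrite lcoef_sum; apply: eq_bigr => k kj; apply: (lexp_XsubC_V_some _).2.
  by rewrite (inj_eq qI) eq_sym.
split=> //; first split.
- apply: lorder_geB; first exact: lorder_geW h0.
  by apply: lorder_geD; [apply: lorder_ge_mono|apply: lorder_geW s0].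
- by rewrite lcoefB lcoefD h0// s0// lcoef_mono eqxx addr0 sub0r.
rewrite lcoefB lcoefD h1 s1 lcoef_mono add0r /regular_part; congr (_ - _).
by rewrite [RHS](bigD1 j)//= subrr invr0 add0r.
Qed.

(** The coefficient a, which collects the derivative of N / P, depends on y but not on v, so its
    contribution to the wedge with dq_j vanishes. *)
Lemma is_derive_regular_part N j y : Mt t y ->
  exists a : C, forall v, is_derive y v (regular_part N j : Pt C m -> C)
    (a * 'D_v (fun z : Pt C m => qc z j : C) y
     + \sum_k (qc y j - qc y k) ^- 2 * ('D_v (fun z : Pt C m => qc z j : C) y
                                       - 'D_v (fun z : Pt C m => qc z k : C) y)).
Proof.
move=> [qI qt].
have P0 : P.[qc y j] != 0 by apply: Ppol_horner_neq0; apply: qt.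
eexists => v.
have dq k : is_derive y v (fun z : Pt C m => qc z k : C) ('D_v (fun z : Pt C m => qc z k : C) y).
  exact/derivableP/diff_derivable/differentiable_qc.
have h1 := is_derive_frac N P0 (dq j).
pose f k (z : Pt C m) : C := (qc z j - qc z k)^-1.
have h2 k : is_derive y v (f k) (- ((qc y j - qc y k) ^- 2 *
    ('D_v (fun z : Pt C m => qc z j : C) y - 'D_v (fun z : Pt C m => qc z k : C) y))).
  (* For k = j the function is identically 0 by 0^-1 = 0, and so is the claimed derivative. *)
  have [<-|kj] := eqVneq j k.
    rewrite !subrr mulr0 oppr0; have -> : f j = cst 0.
      by apply/funext => z; rewrite /f subrr invr0.
    exact: is_derive_cst.
  rewrite -mulNr; apply: is_deriveVf; first by rewrite subr_eq0 (inj_eq qI).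
have h3 := is_deriveB h1 (is_derive_sum h2).
have -> : regular_part N j =
    (fun z : Pt C m => N.[qc z j] / P.[qc z j] : C) - \sum_k f k.
  by apply/funext => z; rewrite /regular_part /= fct_sumE.
by move: h3 => [h3 e3]; apply: DeriveDef => //; rewrite e3 sumrN opprK; reflexivity.
Qed.

Hypotheses (hnu : (2 <= nu)%N) (hm : forall i, (1 <= m i)%N) (tI : injective t).
Hypothesis hOm : forall y, Mt t y -> normal_form t th y (Om y).

Lemma mdelta_conn_at_hol i v y : Mt t y ->
  mx_hol (mdelta v (fun z => conn_at m t i (Om z)) y).
Proof.
move=> My a b; rewrite mxE.
have h : \forall z \near y, lorder_ge 0 (conn_at m t i (Om z) a b - conn_at m t i (Om y) a b).
  apply: filterS (near_Mt My) => z Mz; apply: mx_hol_subE.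
  by apply: conn_at_polar => //; apply: hOm.
exact: (ldelta_near v h).2.
Qed.

(** By [normal_form_numerator] the numerator read off at one point y0 serves for all points. *)
Lemma normal_form_entries y0 : Mt t y0 -> exists N : {poly C}, forall y, Mt t y ->
  exists c, Om y = mx2 0 (tofrac P)^-1 c (tofrac N / tofrac P - simple_poles y) /\
    forall j, lorder_ge (-1) (lexp (Some (qc y j)) c) /\
              lexp (Some (qc y j)) c (-1) = pc y j.
Proof.
move=> My0; have [s0 _ _] := hOm My0.
have [N [c0 [e0 _]]] := normal_shape_entries s0 My0.
exists N => y My; have [s _ _] := hOm My.
have [N' [c [e hc]]] := normal_shape_entries s My.
exists c; split=> //; rewrite e; congr (mx2 _ _ _ (tofrac _ / _ - _)).
apply: (normal_form_numerator hnu hm tI My My0 (hOm My) (hOm My0)).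
  by rewrite e mx2E.
by rewrite e0 mx2E.
Qed.

End Main.

(** * The residue at an apparent singularity q_j *)

Section Apparent.
Variables (C : numClosedFieldType) (nu : nat).
Variables (m : option 'I_nu -> nat) (t : 'I_nu -> C).
Variable th : option 'I_nu -> 'I_2 -> nat -> C.
Hypotheses (hnu : (2 <= nu)%N) (hm : forall i, (1 <= m i)%N) (tI : injective t).
Local Notation P := (Ppol m t).
Variable Om : Pt C m -> 'M[{fraction {poly C}}]_2.
Hypothesis hOm : forall y, Mt t y -> normal_form t th y (Om y).
Implicit Types (y v : Pt C m).
Variables (j : 'I_(nq m)) (X : Pt C m -> nat -> 'M[C]_2).
Hypothesis hX : forall y, Mt t y -> solution_q y j (Om y) (X y).
Hypothesis dX : forall y, Mt t y -> forall s a b,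
  differentiable (fun z : Pt C m => X z s a b : C) y.

Let q (z : Pt C m) : C := qc z j.
(** The power series factor left when diag(1, u) is split off from [psi_q]; on [Mt] its constant
    term is invertible. *)
Let S (z : Pt C m) (s : nat) : 'M[C]_2 := mx2 1 0 (pc z j) 1 *m X z s.
Let W (z : Pt C m) := lform (Some (qc z j)) (Om z).
Let g (z : Pt C m) : C := X z 1%N 1 1.

Lemma SE z s b : S z s 0 b = X z s 0 b /\ S z s 1 b = pc z j * X z s 0 b + X z s 1 b.
Proof. by rewrite /S !mulmx2E !mx2E !mul1r mul0r addr0. Qed.

Lemma S0E z : Mt t z -> S z 0%N = mx2 1 0 (pc z j) 1.
Proof. by move=> /hX[e _ _]; rewrite /S e mulmx1. Qed.

Lemma psi_qE z : psi_q z j (X z) = lser_mx (S z) *m mx2 1 0 0 lX.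
Proof. by rewrite /psi_q lmx_cst_ser. Qed.

Lemma S0_unit z : Mt t z -> S z 0%N \in unitmx.
Proof. by move=> Mz; rewrite S0E// unitmxE det_mx2E !mx2E mulr1 mul0r subr0 unitr1. Qed.

(** The factor diag(1, u) is constant at fixed u, so it comes out of the derivative. *)
Lemma mdelta_psi_q v y :
  mdelta v (fun z => psi_q z j (X z)) y =
  mdelta v (fun z => lser_mx (S z)) y *m mx2 1 0 0 lX.
Proof.
have e0 z i : psi_q z j (X z) i 0 = lser_mx (S z) i 0.
  by rewrite psi_qE mulmx2E !mx2E mulr1 mulr0 addr0.
have e1 z i : psi_q z j (X z) i 1 = lX * lser_mx (S z) i 1.
  by rewrite psi_qE mulmx2E !mx2E mulr0 add0r mulrC.
have hS i b : \forall z \near y, lorder_ge 0 (lser_mx (S z) i b - lser_mx (S y) i b).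
  by near=> z; apply: lorder_geB; apply: mx_hol_ser.
have mdE (L : Pt C m -> 'M[laurent C]_2) i b :
    mdelta v L y i b = ldelta v (fun z => L z i b) y by rewrite mxE.
have d0 i : mdelta v (fun z => psi_q z j (X z)) y i 0 =
    mdelta v (fun z => lser_mx (S z)) y i 0.
  have eF := funext (fun z => e0 z i).
  exact: etrans (mdE _ i 0) (etrans (congr1 (fun L => ldelta v L y) eF) (esym (mdE _ i 0))).
have d1 i : mdelta v (fun z => psi_q z j (X z)) y i 1 =
    lX * mdelta v (fun z => lser_mx (S z)) y i 1.
  have eF := funext (fun z => e1 z i).
  apply: etrans (mdE _ i 1) (etrans (congr1 (fun L => ldelta v L y) eF) _).
  apply: etrans (congr1 (fun f => lX * f) (esym (mdE _ i 1))).
  have [eS _] := ldelta_near v (hS i 1).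
  have h : \forall z \near y, lorder_ge 1 (lX * lser_mx (S z) i 1 - lX * lser_mx (S y) i 1).
    near=> z; rewrite -mulrBr -[X in lorder_ge X]addr0.
    by apply: lorder_geM; [exact: lorder_ge_mono|apply: lorder_geB; apply: mx_hol_ser].
  have [eX _] := ldelta_near v h.
  apply: laurent_eq => k; rewrite lcoef_XM.
  apply: etrans (eX k) (etrans _ (esym (eS (k - 1)))).
  by congr ('D_v _ y); apply/funext => z; apply: lcoef_XM.
have r0 (A : 'M[laurent C]_2) i : (A *m mx2 1 0 0 lX) i 0 = A i 0.
  by rewrite mulmx2E !mx2E mulr1 mulr0 addr0.
have r1 (A : 'M[laurent C]_2) i : (A *m mx2 1 0 0 lX) i 1 = lX * A i 1.
  by rewrite mulmx2E !mx2E mulr0 add0r mulrC.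
apply: eq_mx2; [exact: etrans (d0 0) (esym (r0 _ 0))|exact: etrans (d1 0) (esym (r1 _ 0))|
  exact: etrans (d0 1) (esym (r0 _ 1))|exact: etrans (d1 1) (esym (r1 _ 1))].
Unshelve. all: by end_near. Qed.

(* At fixed local coordinate u, delta(psi) psi^-1 is holomorphic; the motion of the
   centre adds 'D_v q times - psi' psi^-1 = W. *)
Lemma delta_log_psi_q v y : Mt t y ->
  mdelta_at v q (fun z => psi_q z j (X z)) y *m invmx (psi_q y j (X y)) =
  mdelta v (fun z => lser_mx (S z)) y *m invmx (lser_mx (S y)) + lcst ('D_v q y) *: W y.
Proof.
move=> My; have [uS _] := mx_hol_inv (S0_unit My).
have uX : (mx2 1 0 0 lX : 'M[laurent C]_2) \in unitmx.
  rewrite unitmxE det_mx2E !mx2E mul1r mul0r subr0 unitfE.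
  by apply: (@lorder_neq0 _ 1); rewrite lcoef_mono eqxx oner_eq0.
have uPsi : psi_q y j (X y) \in unitmx by rewrite psi_qE unitmx_mul uS.
have [_ _ /= ode] := hX My.
have dpsi : map_mx (fun f => lcst ('D_v q y) * lderiv f) (psi_q y j (X y)) =
    - (lcst ('D_v q y) *: (W y *m psi_q y j (X y))).
  rewrite -scalerN; have <- : map_mx (@lderiv C) (psi_q y j (X y)) = - (W y *m psi_q y j (X y)).
    by apply/eqP; rewrite -addr_eq0; apply/eqP.
  by apply/matrixP => a b; rewrite !mxE.
apply: (canLR (mulmxK uPsi)); rewrite mulmxDl /mdelta_at dpsi opprK.
congr (_ + _); last by rewrite -scalemxAl.
apply: etrans (mdelta_psi_q v y) _.
rewrite psi_qE mulmxA.
exact: (congr1 (fun B => B *m mx2 1 0 0 lX) (esym (mulmxKV uS _))).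
Qed.

Lemma W_entries (N : {poly C}) :
  (forall y, Mt t y ->
    exists c, Om y = mx2 0 (tofrac P)^-1 c (tofrac N / tofrac P - simple_poles y) /\
    forall j, lorder_ge (-1) (lexp (Some (qc y j)) c) /\
              lexp (Some (qc y j)) c (-1) = pc y j) ->
  forall y, Mt t y ->
  [/\ W y 0 0 = 0, lorder_ge 0 (W y 0 1) /\ W y 0 1 0 = P.[qc y j]^-1,
      lorder_ge (-1) (W y 1 0) /\ W y 1 0 (-1) = pc y j,
      lorder_ge (-1) (W y 1 1) /\ W y 1 1 (-1) = -1 & W y 1 1 0 = regular_part t N j y].
Proof. by move=> hN y My; have [c [e /(_ j)[h1 h2]]] := hN y My; exact: (conn_at_q My e h1 h2). Qed.

(** [solution_coef], where W_01 has constant term 1 / P(q_j) and W_11 has constant term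
    [regular_part]. *)
Lemma diagonal_coef (N : {poly C}) :
  (forall y, Mt t y ->
    exists c, Om y = mx2 0 (tofrac P)^-1 c (tofrac N / tofrac P - simple_poles y) /\
    forall j, lorder_ge (-1) (lexp (Some (qc y j)) c) /\
              lexp (Some (qc y j)) c (-1) = pc y j) ->
  forall y, Mt t y -> g y = pc y j / P.[qc y j] - regular_part t N j y.
Proof.
move=> hN y My; have [w00 [h01 e01] [h10 e10] [h11 e11] e0] := W_entries hN My.
have [_ _ /= ode] := hX My; rewrite psi_qE in ode.
have := solution_coef ode w00 h01 h10 e10 h11 e11 (S0E My) (SE y 1%N 1).1 (SE y 1%N 1).2.
by rewrite [lform _ _]/(W y) e01 e0.
Qed.

(** In [res_wedge_expand] the pairings of derivatives of W with M vanish ([T1]), while W' with M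
    ([T2]) and derivatives of W with W ([T3]) both give dg; each contributes dg /\ dq, whence the
    factor 2. *)
Lemma residue_at_q v1 v2 y : Mt t y ->
  let dA v := mdelta_at v q (fun z => lform (Some (qc z j)) (Om z)) y in
  let dP v := mdelta_at v q (fun z => psi_q z j (X z)) y *m invmx (psi_q y j (X y)) in
  res_wedge (dA v1) (dP v1) (dA v2) (dP v2) =
  2 * ('D_v1 g y * 'D_v2 q y - 'D_v2 g y * 'D_v1 q y).
Proof.
move=> My dA dP; have [N hN] := normal_form_entries hnu hm tI hOm My.
have hW := W_entries hN.
have [w00 [h01 e01] [h10 e10] [h11 e11] e0] := hW y My.
have nW := near_Mt My.
pose Wv v := mdelta v W y.
pose M v := mdelta v (fun z => lser_mx (S z)) y *m invmx (lser_mx (S y)).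
have AE v : dA v = Wv v - lcst ('D_v q y) *: map_mx (@lderiv C) (W y).
  rewrite /dA /mdelta_at; congr (_ - _); by apply/matrixP => a b; rewrite !mxE.
have hM v : mx_hol (M v).
  rewrite /M mdelta_ser; apply: mx_holM; first exact: mx_hol_ser.
  exact: (mx_hol_inv (S0_unit My)).2.
have dp v : is_derive y v (fun z : Pt C m => pc z j : C) ('D_v (fun z : Pt C m => pc z j : C) y).
  exact/derivableP/diff_derivable/differentiable_pc.
have dXv v s a b : is_derive y v (fun z : Pt C m => X z s a b : C)
    ('D_v (fun z : Pt C m => X z s a b : C) y).
  exact/derivableP/diff_derivable/dX.
have Mc v : M v 0 1 0 = 0 /\ M v 1 1 1 = pc y j * M v 0 1 1 + 'D_v g y.
  have [uS _] := mx_hol_inv (S0_unit My).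
  have e : M v *m lser_mx (S y) =
      lser_mx (fun s => \matrix_(a, b) 'D_v (fun z => S z s a b : C) y).
    by rewrite /M mulmxKV// mdelta_ser.
  apply: (log_delta_coef (dx := 'D_v (fun z => X z 1%N 0 1 : C) y) (hM v) e
    (S0E My) _ (SE y 1%N 1).1 (SE y 1%N 1).2 _ _).
  (* The shape of S_0 is known only on [Mt], which suffices because [Mt] is a neighbourhood of y. *)
  - have dc a b (f : Pt C m -> C) : (forall z, Mt t z -> S z 0%N a b = f z) ->
        'D_v (fun z => S z 0%N a b : C) y = 'D_v f y.
      by move=> h; apply: near_eq_derive; apply: filterS nW => z /h.
    apply: eq_mx2; rewrite mxE mx2E.
    + by rewrite (dc _ _ (cst 1)) ?derive_cst// => z Mz; rewrite S0E// mx2E.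
    + by rewrite (dc _ _ (cst 0)) ?derive_cst// => z Mz; rewrite S0E// mx2E.
    + by rewrite (dc _ _ (fun z => pc z j))// => z Mz; rewrite S0E// mx2E.
    + by rewrite (dc _ _ (cst 1)) ?derive_cst// => z Mz; rewrite S0E// mx2E.
  - by rewrite mxE; congr ('D_v _ y); apply/funext => z; rewrite (SE z 1%N 1).1.
  - rewrite mxE; have -> : (fun z => S z 1%N 1 1 : C) =
        (fun z => pc z j * X z 1%N 0 1 : C) + g.
      by apply/funext => z; rewrite (SE z 1%N 1).2.
    have h1 := is_deriveMf (dp v) (dXv v 1%N 0 1).
    by have [_ ->] := is_deriveD h1 (dXv v 1%N 1 1).
have mE v a b : Wv v a b = ldelta v (fun z => W z a b) y by rewrite mxE.
have near0 a b : (forall z, Mt t z -> lorder_ge 0 (W z a b)) ->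
    \forall z \near y, lorder_ge 0 (W z a b - W y a b).
  by move=> h; apply: filterS nW => z Mz; apply: lorder_geB; apply: h.
have n00 : \forall z \near y, lorder_ge 0 (W z 0 0 - W y 0 0).
  by apply: near0 => z /hW[-> _ _ _ _].
have n01 : \forall z \near y, lorder_ge 0 (W z 0 1 - W y 0 1).
  by apply: near0 => z /hW[_ [h _] _ _ _].
have n10 : \forall z \near y, lorder_ge (-1) (W z 1 0 - W y 1 0).
  by apply: filterS nW => z /hW[_ _ [h _] _ _]; apply: lorder_geB.
have n11 : \forall z \near y, lorder_ge 0 (W z 1 1 - W y 1 1).
  apply: filterS nW => z /hW[_ _ _ [h e] _] k k0.
  have [km|km] := ltrP k (-1); first exact: (lorder_geB h h11).
  (* The residue of W_11 is -1 at every point, so it cancels in the difference. *)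
  by have -> : k = -1 by [lia]; rewrite lcoefB e e11 subrr.
have v00 v : lorder_ge 0 (Wv v 0 0) by rewrite mE; exact: (ldelta_near v n00).2.
have v01 v : lorder_ge 0 (Wv v 0 1) by rewrite mE; exact: (ldelta_near v n01).2.
have v10 v : lorder_ge (-1) (Wv v 1 0) by rewrite mE; exact: (ldelta_near v n10).2.
have v11 v : lorder_ge 0 (Wv v 1 1) by rewrite mE; exact: (ldelta_near v n11).2.
have c01 v : Wv v 0 1 0 = 'D_v (fun z : Pt C m => P.[qc z j]^-1 : C) y.
  rewrite mE (ldelta_near v n01).1; apply: near_eq_derive.
  by apply: filterS nW => z /hW[_ [_ e] _ _ _].
have c10 v : Wv v 1 0 (-1) = 'D_v (fun z : Pt C m => pc z j : C) y.
  rewrite mE (ldelta_near v n10).1; apply: near_eq_derive.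
  by apply: filterS nW => z /hW[_ _ [_ e] _ _].
have c11 v : Wv v 1 1 0 = 'D_v (regular_part t N j : Pt C m -> C) y.
  rewrite mE (ldelta_near v n11).1; apply: near_eq_derive.
  by apply: filterS nW => z /hW[_ _ _ _ e].
have T1 v v' : rtr (Wv v) (M v') = 0.
  by apply: rtr_mdelta_log => //; exact: (Mc v').1.
have T2 v : rtr (map_mx (@lderiv C) (W y)) (M v) = 'D_v g y.
  rewrite (rtr_deriv_log w00 h01 h10 e10 h11 e11 (hM v)) (Mc v).2; ring.
have T3 v : rtr (Wv v) (W y) = 'D_v g y.
  rewrite (rtr_mdelta_conn (v01 v) (v10 v) (v11 v) w00 h01 h10 e10 h11 e11).
  rewrite c01 c10 c11 e01.
  (* Near y one has g = p_j / P(q_j) - r_j; the product rule splits its differential into the three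
     terms of the pairing. *)
  have -> : 'D_v g y = 'D_v ((fun z : Pt C m => pc z j / P.[qc z j] : C) - regular_part t N j) y.
    by apply: near_eq_derive; apply: filterS nW => z /(diagonal_coef hN).
  have P0 : P.[qc y j] != 0 by apply: Ppol_horner_neq0; apply: My.2.
  have dq : is_derive y v (fun z : Pt C m => qc z j : C) ('D_v (fun z : Pt C m => qc z j : C) y).
    exact/derivableP/diff_derivable/differentiable_qc.
  have dPi := is_deriveVf (f := fun z : Pt C m => P.[qc z j]) (y := y) P0 (is_derive_horner P dq).
  have h1 := is_deriveMf (dp v) dPi.
  have [a /(_ v) h2] := is_derive_regular_part N j My.
  have [_ ->] := is_deriveB h1 h2; have [_ ->] := h2; have [_ ->] := dPi.
  ring.
have PE v : dP v = M v + lcst ('D_v q y) *: W y by exact: delta_log_psi_q.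
set dW := map_mx _ (W y) in AE T2; set W0 := W y in PE T3.
clearbody dA dP M Wv dW W0.
rewrite (AE v1) (AE v2) (PE v1) (PE v2) res_wedge_expand.
rewrite (T1 v1 v2) (T1 v2 v1) (T2 v1) (T2 v2) (T3 v1) (T3 v2).
move: ('D_v1 q y) ('D_v2 q y) ('D_v1 g y) ('D_v2 g y) => b1 b2 a1 a2; ring.
Qed.

End Apparent.

(** * Cancellation by symmetry and the final formula *)

Lemma sum_dq_wedge0 (F : numFieldType) n (x : 'I_n -> F) (a b : 'I_n -> F) :
  \sum_j ((\sum_k (x j - x k) ^- 2 * (a j - a k)) * b j
          - (\sum_k (x j - x k) ^- 2 * (b j - b k)) * a j) = 0.
Proof.
set s := \sum_j _.
have e : s = \sum_j \sum_k (x j - x k) ^- 2 * (b k * a j - a k * b j).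
  apply: eq_bigr => j _; rewrite !mulr_suml -sumrB; apply: eq_bigr => k _; ring.
(* Exchanging j and k keeps the weight (x_j - x_k)^-2 and changes the sign of the bracket;
   characteristic 0 then gives s = 0. *)
have : s = - s.
  rewrite [in LHS]e exchange_big e -sumrN; apply: eq_bigr => j _.
  rewrite -sumrN; apply: eq_bigr => k _.
  by rewrite -[x k - x j]opprB sqrrN; ring.
by move/eqP; rewrite -addr_eq0 -mulr2n mulrn_eq0 => /eqP.
Qed.

(** The residues at the t_i vanish by holomorphy; at the q_j the factors 1/2 and 2 cancel, leaving
    the sum of dg_j /\ dq_j, where g_j = p_j / P(q_j) - r_j. *)
Lemma omega_formula (C : numClosedFieldType) (nu : nat) (hnu : (2 <= nu)%N)
    (m : option 'I_nu -> nat) (hm : forall i, (1 <= m i)%N)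
    (t : 'I_nu -> C) (tI : injective t) (th : option 'I_nu -> 'I_2 -> nat -> C)
    (Om : Pt C m -> 'M[{fraction {poly C}}]_2)
    (hOm : forall y, Mt t y -> normal_form t th y (Om y))
    (Phi : option 'I_nu -> 'M[C]_2)
    (hPhi : forall i y, Mt t y -> compatible_framing m t th i (Phi i) (Om y))
    (Xi : option 'I_nu -> Pt C m -> nat -> 'M[C]_2)
    (TH : option 'I_nu -> Pt C m -> 'I_2 -> nat -> C)
    (hXi : forall i y, Mt t y ->
      formal_solution m t th i (Phi i) (Om y) (Xi i y) (TH i y))
    (Xiq : 'I_(nq m) -> Pt C m -> nat -> 'M[C]_2)
    (hXiq : forall j y, Mt t y -> solution_q y j (Om y) (Xiq j y))
    (dXiq : forall j y, Mt t y -> forall s a b,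
      differentiable (fun z : Pt C m => Xiq j z s a b : C) y) :
  forall y v1 v2 : Pt C m, Mt t y ->
    omega t Om (fun i z => psi_t m i (Phi i) (Xi i z) (TH i z))
      (fun j z => psi_q z j (Xiq j z)) v1 v2 y =
    \sum_(j < nq m)
      dwedge (fun z => pc z j / (Ppol m t).[qc z j]) (fun z => qc z j) v1 v2 y.
Proof.
move=> y v1 v2 My.
pose dq j v : C := 'D_v (fun z : Pt C m => qc z j : C) y.
pose f j (z : Pt C m) : C := pc z j / (Ppol m t).[qc z j].
have [N hN] := normal_form_entries hnu hm tI hOm My.
pose S j v : C := \sum_k (qc y j - qc y k) ^- 2 * (dq j v - dq k v).
pose g j (z : Pt C m) : C := Xiq j z 1%N 1 1.
have gE j : exists a : C, forall v, 'D_v (g j) y = 'D_v (f j) y - (a * dq j v + S j v).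
  have [a ha] := is_derive_regular_part N j My.
  exists a => v; have [h1 h2] := ha v; rewrite -h2.
  have -> : 'D_v (g j) y = 'D_v (f j - regular_part t N j) y.
    apply: near_eq_derive; apply: filterS (near_Mt My) => z.
    exact: (diagonal_coef (hXiq j) hN).
  have P0 : (Ppol m t).[qc y j] != 0 by apply: Ppol_horner_neq0; apply: My.2.
  have hq : is_derive y v (fun z : Pt C m => qc z j : C) (dq j v).
    exact/derivableP/diff_derivable/differentiable_qc.
  have hp : is_derive y v (fun z : Pt C m => pc z j : C) ('D_v (fun z : Pt C m => pc z j : C) y).
    exact/derivableP/diff_derivable/differentiable_pc.
  have hP := is_deriveVf (f := fun z : Pt C m => (Ppol m t).[qc z j]) (y := y) P0
    (is_derive_horner _ hq).
  have [hf _] := is_deriveMf hp hP.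
  by have [_ ->] := is_deriveB (derivableP hf) (ha v); rewrite h2.
rewrite /omega big1 ?mulr0 ?add0r; last first.
  move=> i _; apply: res_wedge_hol.
  - exact: (mdelta_conn_at_hol hnu hm tI hOm).
  - exact: (fe_delta_log_hol v1 (hPhi i y My).1 (hXi i) My).
  - exact: (mdelta_conn_at_hol hnu hm tI hOm).
  - exact: (fe_delta_log_hol v2 (hPhi i y My).1 (hXi i) My).
under eq_bigr => j _ do
  rewrite (residue_at_q hnu hm tI hOm (hXiq j) (dXiq j) v1 v2 My).
rewrite -mulr_sumr mulKf ?pnatr_eq0//.
apply/eqP; rewrite -subr_eq0 -sumrB; apply/eqP.
(* Since a dq_j /\ dq_j = 0, only the terms [S] of dr_j remain; v2 is put in the first slot to match
   the minus sign before r_j. *)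
rewrite -[RHS](sum_dq_wedge0 (qc y) (fun j => dq j v2) (fun j => dq j v1)).
apply: eq_bigr => j _; have [a ha] := gE j.
change ('D_v1 (g j) y * dq j v2 - 'D_v2 (g j) y * dq j v1 -
  ('D_v1 (f j) y * dq j v2 - 'D_v2 (f j) y * dq j v1) =
  S j v2 * dq j v1 - S j v1 * dq j v2).
rewrite (ha v1) (ha v2).
move: (S j v1) (S j v2) (dq j v1) (dq j v2) ('D_v1 (f j) y) ('D_v2 (f j) y) => *; ring.
Qed.

Theorem theorem3p4 (R : realType) (nu : nat) (hnu : (2 <= nu)%N)
    (m : option 'I_nu -> nat) (hm : forall i, (1 <= m i)%N)
    (t : 'I_nu -> CC R) (ht : in_Tt t)
    (th : option 'I_nu -> 'I_2 -> nat -> CC R) (hth : exponents_ok m th)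
    (Om : Pt (CC R) m -> 'M[{fraction {poly CC R}}]_2)
    (hOm : forall y, Mt t y -> normal_form t th y (Om y))
    (Phi : option 'I_nu -> 'M[CC R]_2)
    (hPhi : forall i y, Mt t y -> compatible_framing m t th i (Phi i) (Om y))
    (Xi : option 'I_nu -> Pt (CC R) m -> nat -> 'M[CC R]_2)
    (TH : option 'I_nu -> Pt (CC R) m -> 'I_2 -> nat -> CC R)
    (hXi : forall i y, Mt t y ->
      formal_solution m t th i (Phi i) (Om y) (Xi i y) (TH i y))
    (Xiq : 'I_(nq m) -> Pt (CC R) m -> nat -> 'M[CC R]_2)
    (hXiq : forall j y, Mt t y -> solution_q y j (Om y) (Xiq j y))
    (dXiq : forall j y, Mt t y -> forall s a b,
      differentiable (fun z : Pt (CC R) m => Xiq j z s a b : CC R) y) :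
  forall y v1 v2 : Pt (CC R) m, Mt t y ->
    omega t Om (fun i z => psi_t m i (Phi i) (Xi i z) (TH i z))
      (fun j z => psi_q z j (Xiq j z)) v1 v2 y =
    \sum_(j < nq m)
      dwedge (fun z => pc z j / (Ppol m t).[qc z j]) (fun z => qc z j) v1 v2 y.
Proof. by case: ht => tI _ _; apply: (omega_formula hnu hm tI hOm hPhi hXi hXiq dXiq). Qed.
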